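(* Let $N$ be a matroid with at least two elements. Suppose that for every $N$-connected matroid $M$ with $|E(M)| > |E(N)|$ and for every element $e \in E(M)$, at least one of $M \backslash e$ and $M / e$ is $N$-connected. Then $N$ is isomorphic to one of $U_{1,2}$, $U_{0,2}$, or $U_{2,2}$.
   Context: A matroid $M$ uses a set $Z$ if $Z \subseteq E(M)$. For a matroid $N$, a matroid $M$ with $|E(M)| \geq 2$ is $N$-connected if for every pair of distinct elements $e,f \in E(M)$ there is a minor of $M$ isomorphic to $N$ that uses $\{e,f\}$. *)

(* Defs.v *)
From mathcomp Require Import all_boot.
From mathcomp Require Import zify.

Set Implicit Arguments.
Unset Strict Implicit.
Unset Printing Implicit Defensive.

(* Finite matroids, given by their independent sets.  The ground set is a
   subset of an ambient finite type, so that a matroid and all its minors live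
   over the same type.  The axioms are boolean, so two matroids over T are equal
   as soon as their ground sets and their independent sets are. *)
Definition matroid_axiom (T : finType) (E : {set T}) (F : {set {set T}}) :=
  [&& [forall I : {set T}, (I \in F) ==> (I \subset E)],
      set0 \in F,
      [forall J : {set T}, forall I : {set T},
        (J \in F) && (I \subset J) ==> (I \in F)]
    & [forall I : {set T}, forall J : {set T},
        [&& I \in F, J \in F & #|I| < #|J|] ==>
        [exists x : T, (x \in J :\: I) && (x |: I \in F)]]].

Record matroid (T : finType) := Matroid {
  ground : {set T};
  indep : {set {set T}};
  matroidP : matroid_axiom ground indep
}.

Lemma matroid_axiomP (T : finType) (E : {set T}) (F : {set {set T}}) :
  reflect [/\ forall I : {set T}, I \in F -> I \subset E,
              set0 \in F,
              forall I J : {set T}, J \in F -> I \subset J -> I \in F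
            & forall I J : {set T}, I \in F -> J \in F -> #|I| < #|J| ->
                exists2 x, x \in J :\: I & x |: I \in F]
          (matroid_axiom E F).
Proof.
apply: (iffP and4P) => [] [h1 h2 h3 h4]; split=> //.
- by move=> I; apply/implyP; move/forallP: h1.
- move=> I J FJ sIJ; have /forallP/(_ I)/implyP := forallP h3 J.
  by apply; rewrite FJ.
- move=> I J FI FJ lt; have /forallP/(_ J)/implyP := forallP h4 I.
  by rewrite FI FJ lt => /(_ isT)/exists_inP.
- by apply/forallP=> I; apply/implyP; exact: h1.
- apply/forallP=> J; apply/forallP=> I; apply/implyP=> /andP[]; exact: h3.
apply/forallP=> I; apply/forallP=> J; apply/implyP=> /and3P[FI FJ lt].
by apply/exists_inP; exact: h4.
Qed.

Definition base (T : finType) (M : matroid T) (B : {set T}) :=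
  maxset [pred I | I \in indep M] B.

Section Bases.

Variables (T : finType) (M : matroid T).
Implicit Types I J B : {set T}.

Lemma indep_sub I : I \in indep M -> I \subset ground M.
Proof. by case/matroid_axiomP: (matroidP M) => h _ _ _; exact: h. Qed.

Lemma indep0 : set0 \in indep M.
Proof. by case/matroid_axiomP: (matroidP M). Qed.

Lemma indepS I J : J \in indep M -> I \subset J -> I \in indep M.
Proof. by case/matroid_axiomP: (matroidP M) => _ _ h _; exact: h. Qed.

Lemma indep_aug I J : I \in indep M -> J \in indep M -> #|I| < #|J| ->
  exists2 x, x \in J :\: I & x |: I \in indep M.
Proof. by case/matroid_axiomP: (matroidP M) => _ _ _ h; exact: h. Qed.

Lemma base_indep B : base M B -> B \in indep M.
Proof. by case/maxsetP. Qed.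

Lemma base_exists : exists B, base M B.
Proof.
have h : [pred I | I \in indep M] set0 by exact: indep0.
by have [B hB _] := maxset_exists h; exists B.
Qed.

Lemma indep_le_base I B : I \in indep M -> base M B -> #|I| <= #|B|.
Proof.
move=> hI /maxsetP[hB maxB]; rewrite leqNgt; apply/negP=> lt.
have [x /setDP[_ xB] hx] := indep_aug hB hI lt.
have eqB := maxB _ hx (subsetUr _ _).
by move: xB; rewrite -eqB setU11.
Qed.

Lemma indep_card_base I B : I \in indep M -> base M B -> #|B| <= #|I| ->
  base M I.
Proof.
move=> hI bB le; apply/maxsetP; split=> // J /= hJ sIJ.
apply/esym/eqP; rewrite eqEcard sIJ /=.
exact: leq_trans (indep_le_base hJ bB) le.
Qed.

Lemma base_extend I B : I \in indep M -> base M B ->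
  exists B', [/\ base M B', I \subset B' & B' \subset I :|: B].
Proof.
move: {2}(#|B| - #|I|) (leqnn (#|B| - #|I|)) => n.
elim: n I => [|n IHn] I le hI bB.
  exists I; split=> //; last exact: subsetUl.
  by apply: (indep_card_base hI bB); rewrite -subn_eq0 -leqn0.
have [leBI|ltIB] := leqP #|B| #|I|.
  by exists I; split=> //; [exact: indep_card_base bB _ | exact: subsetUl].
have [x /setDP[xB xI] hx] := indep_aug hI (base_indep bB) ltIB.
have [|B' [bB' sB' sB'2]] := IHn (x |: I) _ hx bB.
  by rewrite cardsU1 xI; lia.
exists B'; split=> //; first exact: subset_trans (subsetUr _ _) sB'.
apply: subset_trans sB'2 _; rewrite subUset subsetUr andbT.
by rewrite subUset subsetUl andbT sub1set inE xB orbT.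
Qed.

Definition dual_indep :=
  [set I : {set T} | [exists B, base M B && (I \subset ground M :\: B)]].

Lemma dual_indepP I :
  reflect (exists2 B, base M B & I \subset ground M :\: B)
          (I \in dual_indep).
Proof. by rewrite inE; exact: exists_inP. Qed.

Lemma dual_axiom : matroid_axiom (ground M) dual_indep.
Proof.
apply/matroid_axiomP; split.
- move=> I /dual_indepP[B _ sI]; exact: subset_trans sI (subsetDl _ _).
- by have [B bB] := base_exists; apply/dual_indepP; exists B; rewrite ?sub0set.
- move=> I J /dual_indepP[B bB sJ] sIJ; apply/dual_indepP; exists B => //.
  exact: subset_trans sIJ sJ.
move=> I J /dual_indepP[BI bI]; rewrite subsetD => /andP[sIE dI].
move=> /dual_indepP[BJ bJ]; rewrite subsetD => /andP[sJE dJ] ltIJ.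
have hK : BJ :\: I \in indep M by apply: indepS (base_indep bJ) (subsetDl _ _).
have [B [bB sKB sBU]] := base_extend hK bI.
have dIB : [disjoint I & B].
  apply: disjointWr sBU _; rewrite -setI_eq0 setIUr setDE setICA setICr setI0.
  by rewrite set0U setI_eq0.
have [sJIB|/subsetPn[x /setDP[xJ xI] xB]] := boolP (J :\: I \subset B).
  have dKJ : [disjoint BJ :\: I & J :\: I].
    apply: disjointWl (subsetDl _ _) _; rewrite disjoint_sym.
    exact: disjointWl (subsetDl _ _) dJ.
  have /subset_leq_card : (BJ :\: I) :|: (J :\: I) \subset B by rewrite subUset sKB.
  rewrite cardsU (disjoint_setI0 dKJ) cards0 subn0.
  have := indep_le_base (base_indep bB) bJ.
  have := cardsID I BJ; have := cardsID I J; have := cardsID J I.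
  have /subset_leq_card : BJ :&: I \subset I :\: J.
    by rewrite subsetD subsetIr /= disjoint_sym; apply: disjointWr (subsetIl _ _) dJ.
  rewrite (setIC I J); lia.
exists x; first by rewrite inE xI.
apply/dual_indepP; exists B => //; rewrite subUset sub1set inE xB.
by rewrite (subsetP sJE) //= subsetD sIE.
Qed.

End Bases.

(* The bases of the dual are the complements of the bases. *)
Definition dual (T : finType) (M : matroid T) : matroid T :=
  Matroid (dual_axiom M).

Definition del_indep (T : finType) (M : matroid T) (X : {set T}) :=
  [set I in indep M | I \subset ground M :\: X].

Lemma del_axiom (T : finType) (M : matroid T) (X : {set T}) :
  matroid_axiom (ground M :\: X) (del_indep M X).
Proof.
apply/matroid_axiomP; split.
- by move=> I; rewrite inE => /andP[].
- by rewrite inE indep0 sub0set.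
- move=> I J; rewrite !inE => /andP[hJ sJ] sIJ.
  by rewrite (indepS hJ sIJ) (subset_trans sIJ sJ).
move=> I J; rewrite !inE => /andP[hI sI] /andP[hJ sJ] lt.
have [x xJI hx] := indep_aug hI hJ lt; exists x => //.
have /setDP[xJ _] := xJI.
by rewrite inE hx subUset sI sub1set (subsetP sJ).
Qed.

Definition deletion (T : finType) (M : matroid T) (X : {set T}) : matroid T :=
  Matroid (del_axiom M X).

Definition contraction (T : finType) (M : matroid T) (X : {set T}) :
    matroid T :=
  dual (deletion (dual M) X).

Definition is_minor (T : finType) (M' M : matroid T) : Prop :=
  exists C D : {set T},
    [/\ C \subset ground M, D \subset ground M, [disjoint C & D]
      & M' = deletion (contraction M C) D].

Definition matroid_iso (T U : finType) (M : matroid T) (N : matroid U) : Prop :=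
  exists2 phi : {x | x \in ground M} -> {y | y \in ground N},
    bijective phi &
    forall I : {set {x | x \in ground M}},
      (val @: I \in indep M) = (val @: (phi @: I) \in indep N).

Definition uses (T : finType) (M : matroid T) (Z : {set T}) : bool :=
  Z \subset ground M.

Definition matroid_connected (U T : finType) (N : matroid U) (M : matroid T) :
    Prop :=
  2 <= #|ground M| /\
  forall e f, e \in ground M -> f \in ground M -> e != f ->
    exists M' : matroid T,
      [/\ is_minor M' M, matroid_iso M' N & uses M' [set e; f]].

Definition uniform_indep (r n : nat) := [set I : {set 'I_n} | #|I| <= r].

Lemma uniform_axiom r n : matroid_axiom [set: 'I_n] (uniform_indep r n).
Proof.
apply/matroid_axiomP; split.
- by move=> I _; exact: subsetT.
- by rewrite inE cards0.
- by move=> I J; rewrite !inE => leJ /subset_leq_card /leq_trans; exact.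
move=> I J; rewrite !inE => _ leJ lt.
have /subsetPn[x xJ xI] : ~~ (J \subset I).
  by apply/negP=> /subset_leq_card; rewrite leqNgt lt.
exists x; first by rewrite inE xI.
by rewrite inE cardsU1 xI; exact: leq_trans lt leJ.
Qed.

(* U_{r,n}, for r <= n. *)
Definition uniform (r n : nat) : matroid 'I_n := Matroid (uniform_axiom r n).

(* Main.v *)
Require Import Defs.
From mathcomp Require Import all_boot.
From mathcomp Require Import zify.

Set Implicit Arguments.
Unset Strict Implicit.
Unset Printing Implicit Defensive.

(** Write n = |E(N)|. The hypothesis on N is self-dual, and iterating it shows
    that every N-connected matroid M has an N-minor on each n-subset X of its
    ground set. Choosing M and X badly enough gives the contradictions below;
    call two elements twins if they are both loops or are parallel.
    - If N has twins, enlarging their class to n elements gives an N-connected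
      M; taking X inside the class forces N = U_{1,n} or N = U_{0,n}. For n >= 3
      the first is excluded by three parallel classes in rank 2, and the second,
      after dualizing to U_{n,n}, by U_{n-1,n} plus a coloop. The case where the
      dual of N has twins is dual.
    - Otherwise suppose that N has a circuit with at least two elements; let p
      be one of them and C the component of p. The 2-sum at p of N and N|C is
      N-connected and has a 2-separation. An X with two elements a, a' on the
      side of C - p gives a pair of elements of N with connectivity at most 1 to
      the rest. Keeping the loop and the coloop of N, if any, in X ensures that
      this pair has no loop and no coloop, so it is parallel or in series.
    - Otherwise N is a loop plus a coloop, for which n-subsets carry no
      information. The rank-3 whirl has no clones, hence is N-connected, but it
      has an element e in a triangle and in a triad, so M\e has a series pair and
      M/e has a parallel pair. *)

(** * Rank functions *)

Lemma matroid_eq (T : finType) (M M' : matroid T) :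
  ground M = ground M' -> indep M = indep M' -> M = M'.
Proof.
case: M => E F P; case: M' => E' F' P' /= eE eF; subst E' F'.
by rewrite (bool_irrelevance P P').
Qed.

Section Rank.

Variables (T : finType) (M : matroid T).
Implicit Types I J W X Y Z : {set T}.

Definition rk X := \max_(I in indep M | I \subset X) #|I|.

Lemma indep_rk I X : I \in indep M -> I \subset X -> #|I| <= rk X.
Proof.
move=> hI sI; rewrite /rk.
by rewrite (@leq_bigmax_cond _ _ (fun I => #|I|) I) // hI.
Qed.

Lemma rk_leP X n :
  reflect (forall I, I \in indep M -> I \subset X -> #|I| <= n) (rk X <= n).
Proof.
apply: (iffP (@bigmax_leqP _ _ _ _)) => h I; last by case/andP=> ? ?; exact: h.
by move=> hI sI; apply: h; rewrite hI.
Qed.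

Lemma rk_basis X : exists I, [/\ I \in indep M, I \subset X & #|I| = rk X].
Proof.
have h0 : (set0 \in indep M) && (set0 \subset X) by rewrite indep0 sub0set.
pose P := [pred I : {set T} | (I \in indep M) && (I \subset X)].
case: (@arg_maxnP _ set0 P (fun J : {set T} => #|J|) h0) => I /andP[hI sI] maxI.
exists I; split=> //; apply/eqP; rewrite eqn_leq indep_rk //=.
by apply/rk_leP=> J hJ sJ; apply: maxI; rewrite /= hJ.
Qed.

Lemma rkS X Y : X \subset Y -> rk X <= rk Y.
Proof.
by move=> sXY; apply/rk_leP=> I hI sI; apply/(indep_rk hI)/(subset_trans sI).
Qed.

Lemma rk_card X : rk X <= #|X|.
Proof. by apply/rk_leP=> I _; exact: subset_leq_card. Qed.

Lemma rk0 : rk set0 = 0.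
Proof. by apply/eqP; rewrite -leqn0 -(cards0 T) rk_card. Qed.

Lemma indepE I : (I \in indep M) = (rk I == #|I|).
Proof.
apply/idP/eqP=> [hI|eI].
  by apply/eqP; rewrite eqn_leq rk_card indep_rk.
have [J [hJ sJ eJ]] := rk_basis I.
have /eqP <- // : J == I by rewrite eqEcard sJ eJ eI leqnn.
Qed.

Lemma rk_extend I X : I \in indep M -> I \subset X ->
  exists J, [/\ J \in indep M, I \subset J, J \subset X & #|J| = rk X].
Proof.
move=> hI sIX.
pose P := [pred J : {set T} | [&& J \in indep M, I \subset J & J \subset X]].
have h0 : P I by rewrite /= hI sIX subxx.
case: (@arg_maxnP _ I P (fun J : {set T} => #|J|) h0) => J /and3P[hJ sIJ sJX] maxJ.
exists J; split=> //; apply/eqP; rewrite eqn_leq indep_rk //= leqNgt.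
apply/negP=> lt; have [K [hK sK eK]] := rk_basis X.
rewrite -eK in lt; have [x /setDP[xK xJ] hx] := indep_aug hJ hK lt.
have /maxJ /= : [&& x |: J \in indep M, I \subset x |: J & x |: J \subset X].
  rewrite hx (subset_trans sIJ (subsetUr _ _)) subUset sJX sub1set.
  by rewrite (subsetP sK).
by rewrite cardsU1 xJ add1n => /ltn_geF; rewrite leqnn.
Qed.

(** Submodularity. Allowing [Z] and [W] to be merely contained in the union and the intersection
    leaves each application with two inclusions to check. *)
Lemma rk_submod X Y Z W : Z \subset X :|: Y -> W \subset X :&: Y ->
  rk Z + rk W <= rk X + rk Y.
Proof.
move=> sZ sW.
have [K [hK sK eK]] := rk_basis (X :&: Y).
have sKU : K \subset X :|: Y.
  by apply: subset_trans sK _; apply/subsetP=> x; rewrite !inE => /andP[->].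
have [J [hJ sKJ sJ eJ]] := rk_extend hK sKU.
have hX := indep_rk (indepS hJ (subsetIl J X)) (subsetIr J X).
have hY := indep_rk (indepS hJ (subsetIl J Y)) (subsetIr J Y).
have := cardsUI (J :&: X) (J :&: Y); rewrite -setIUr (setIidPl sJ) => e.
have : #|K| <= #|J :&: X :&: (J :&: Y)|.
  apply: subset_leq_card; apply/subsetP=> x xK; rewrite !inE (subsetP sKJ) //.
  by have := subsetP sK x xK; rewrite inE.
have := rkS sZ; have := rkS sW; lia.
Qed.

Lemma rkU X Y : rk (X :|: Y) <= rk X + rk Y.
Proof.
by have := @rk_submod X Y (X :|: Y) set0; rewrite rk0 addn0; apply=> //; exact: sub0set.
Qed.

Lemma baseE B : base M B = (B \in indep M) && (#|B| == rk (ground M)).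
Proof.
apply/idP/andP=> [bB|[hB /eqP eB]].
  have hB := base_indep bB; split=> //; rewrite eqn_leq indep_rk ?indep_sub //=.
  by apply/rk_leP=> I hI _; exact: indep_le_base hI bB.
apply/maxsetP; split=> // J /= hJ sBJ; apply/esym/eqP; rewrite eqEcard sBJ eB /=.
by rewrite indep_rk ?indep_sub.
Qed.

Lemma indep_dual I :
  (I \in indep (dual M)) =
  (I \subset ground M) && (rk (ground M :\: I) == rk (ground M)).
Proof.
apply/dual_indepP/andP=> [[B]|[sI /eqP eI]].
  rewrite baseE subsetD => /andP[hB /eqP eB] /andP[sI dI]; split=> //.
  rewrite eqn_leq rkS ?subsetDl //= -eB indep_rk // subsetD indep_sub //=.
  by rewrite disjoint_sym.
have [B [hB sB eB]] := rk_basis (ground M :\: I).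
exists B; first by rewrite baseE hB eB eI /=.
move: sB; rewrite !subsetD => /andP[_ dB]; by rewrite sI disjoint_sym.
Qed.

End Rank.

Section Operations.

Variables (T : finType) (M : matroid T).
Implicit Types I J X Y C D : {set T}.

(** The formula r*(X) = |X| + r(E - X) - r(E), kept free of subtraction. For the lower bound, a
    basis of E - X extends to a base [B] of M, and X - B is independent in the dual. *)
Lemma rk_dual X : X \subset ground M ->
  rk (dual M) X + rk M (ground M) = #|X| + rk M (ground M :\: X).
Proof.
move=> sX; set E := ground M; apply/eqP; rewrite eqn_leq; apply/andP; split.
  have [I [hI sI <-]] := rk_basis (dual M) X.
  move: hI; rewrite indep_dual -/E => /andP[_ /eqP <-].
  have := rkU M (E :\: X) (X :\: I); have := rk_card M (X :\: I).
  have := cardsD X I; rewrite (setIidPr sI).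
  have := subset_leq_card sI.
  have /(rkS M) : E :\: I \subset (E :\: X) :|: (X :\: I).
    by apply/subsetP=> x; rewrite !inE; do 3 case: (x \in _).
  lia.
have [K [hK sK eK]] := rk_basis M (E :\: X).
have sKE := subset_trans sK (subsetDl _ _).
have [B [hB sKB sB eB]] := rk_extend hK sKE.
have hI : X :\: B \in indep (dual M).
  rewrite indep_dual (subset_trans (subsetDl _ _)) //= eqn_leq rkS ?subsetDl //=.
  rewrite -/E -eB indep_rk //; apply/subsetP=> x xB; rewrite !inE xB /=.
  by apply: (subsetP sB).
have := indep_rk hI (subsetDl _ _); have := cardsID B X; rewrite -eK -eB.
have : K :|: (X :&: B) \subset B by rewrite subUset sKB subsetIr.
move/subset_leq_card; rewrite cardsU.
have -> : K :&: (X :&: B) = set0.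
  apply/setP=> x; rewrite !inE; apply/negP=> /and3P[xK xX _].
  by have := subsetP sK x xK; rewrite inE xX.
rewrite cards0; lia.
Qed.

Lemma indep_deletion X I :
  (I \in indep (deletion M X)) = (I \in indep M) && [disjoint I & X].
Proof.
rewrite inE subsetD; case hI: (I \in indep M) => //=.
by rewrite indep_sub.
Qed.

Lemma rk_deletion X Y : rk (deletion M X) Y = rk M (Y :\: X).
Proof.
apply/eqP; rewrite eqn_leq; apply/andP; split; apply/rk_leP=> I.
  rewrite indep_deletion => /andP[hI dI] sI.
  by rewrite indep_rk // subsetD sI.
rewrite subsetD => hI /andP[sI dI]; apply: indep_rk => //.
by rewrite indep_deletion hI.
Qed.

End Operations.

Lemma dualK (T : finType) (M : matroid T) : dual (dual M) = M.
Proof.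
apply: matroid_eq => //; apply/setP=> I; rewrite indep_dual /=.
have [sI|sI] := boolP (I \subset ground M); last first.
  by apply/esym/negbTE; apply: contra sI; exact: indep_sub.
rewrite indepE /=; apply/eqP/eqP.
  have := rk_dual (subsetDl (ground M) I); have := rk_dual (subxx (ground M)).
  rewrite setDv rk0 setDDr setDv set0U (setIidPr sI).
  have := cardsD (ground M) I; rewrite (setIidPr sI).
  have := subset_leq_card sI; have := rk_card M I.
  lia.
have := rk_dual (subsetDl (ground M) I); have := rk_dual (subxx (ground M)).
rewrite setDv rk0 setDDr setDv set0U (setIidPr sI).
have := cardsD (ground M) I; rewrite (setIidPr sI).
have := subset_leq_card sI; have := rk_card M I.
lia.
Qed.

Section Contraction.

Variables (T : finType) (M : matroid T).
Implicit Types I J X Y C D : {set T}.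

(** A contraction is by definition the dual of a deletion from the dual, so [rk_dual], used on the
    complements of [C] and of [I :|: C], brings the ranks back to M. *)
Lemma indep_contraction C I : C \subset ground M ->
  (I \in indep (contraction M C)) =
  (I \subset ground M :\: C) && (rk M (I :|: C) == #|I| + rk M C).
Proof.
move=> sC; rewrite indep_dual /=; set E := ground M.
have [sI|] //= := boolP (I \subset E :\: C).
rewrite !rk_deletion -/E.
have -> : E :\: C :\: I :\: C = E :\: (I :|: C).
  by apply/setP=> x; rewrite !inE; do 2 case: (x \in _).
have -> : E :\: C :\: C = E :\: C by rewrite setDDl setUid.
have [sIE dI] : I \subset E /\ [disjoint I & C] by apply/andP; rewrite -subsetD.
have sIC : I :|: C \subset E by rewrite subUset sIE sC.
have := rk_dual (subsetDl E (I :|: C)); have := rk_dual (subsetDl E C).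
rewrite !setDDr !setDv !set0U (setIidPr sIC) (setIidPr sC).
have := cardsD E (I :|: C); have := cardsD E C; rewrite -/E (setIidPr sIC) (setIidPr sC).
have := subset_leq_card sIC.
rewrite cardsU (disjoint_setI0 dI) cards0 subn0.
move=> h1 h2 h3 h4 h5.
have h6: rk M (I :|: C) <= #|I| + rk M C.
  have := rkU M I C; have := rk_card M I; lia.
by apply/eqP/eqP; lia.
Qed.

Lemma rk_contraction C Y : C \subset ground M ->
  rk (contraction M C) Y + rk M C = rk M (Y :|: C).
Proof.
move=> sC; apply/eqP; rewrite eqn_leq; apply/andP; split.
  have [I [hI sI <-]] := rk_basis (contraction M C) Y.
  move: hI; rewrite indep_contraction // => /andP[_ /eqP <-].
  by rewrite rkS // setSU.
(* A basis of [C] extended within [Y :|: C] meets [C] in a basis of [C], so what remains of it is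
   independent in the contraction. *)
have [K [hK sK eK]] := rk_basis M C.
have sKU : K \subset Y :|: C by apply: subset_trans sK (subsetUr _ _).
have [J [hJ sKJ sJ eJ]] := rk_extend hK sKU.
have sJC : J :&: C \subset C by exact: subsetIr.
have h1 := indep_rk (indepS hJ (subsetIl J C)) sJC.
have h2 : #|K| <= #|J :&: C| by apply: subset_leq_card; rewrite subsetI sKJ.
have hI : J :\: C \in indep (contraction M C).
  rewrite indep_contraction // setSD ?indep_sub //=.
  have := rkU M (J :\: C) C; have := rk_card M (J :\: C).
  have : J \subset J :\: C :|: C by apply/subsetP=> x; rewrite !inE orbC => ->; case: (_ \in C).
  move/(indep_rk hJ); have := cardsID C J.
  have /(rkS M) : J :\: C :|: C \subset Y :|: C.
    by rewrite subUset subsetUr (subset_trans (subsetDl _ _)).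
  move=> *; apply/eqP; lia.
have : J :\: C \subset Y.
  by apply/subsetP=> x; rewrite inE => /andP[/negbTE xC /(subsetP sJ)]; rewrite inE xC orbF.
move/(indep_rk hI); have := cardsID C J; lia.
Qed.

End Contraction.

(** * Minors and N-connectivity *)

Section Isomorphisms.

Variables (U T : finType) (N : matroid U) (M : matroid T).
Implicit Types (g : U -> T) (C : {set T}).

Lemma rk_iso g : {in ground N &, injective g} ->
  (forall I : {set U}, I \subset ground N ->
     (I \in indep N) = (g @: I \in indep M)) ->
  forall I : {set U}, I \subset ground N -> rk M (g @: I) = rk N I.
Proof.
move=> injg hg I sI; apply/eqP; rewrite eqn_leq; apply/andP; split; last first.
  have [J [hJ sJ <-]] := rk_basis N I; have sJN := subset_trans sJ sI.
  rewrite -(card_in_imset (sub_in2 (subsetP sJN) injg)).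
  by rewrite indep_rk -?hg ?imsetS.
have [J [hJ sJ <-]] := rk_basis M (g @: I).
have eJ : g @: (I :&: g @^-1: J) = J.
  apply/setP=> y; apply/imsetP/idP=> [[x]|yJ].
    by rewrite !inE => /andP[_ gx] ->.
  have /imsetP[x xI e] := subsetP sJ y yJ.
  by exists x => //; rewrite !inE xI -e.
have sIJ : I :&: g @^-1: J \subset ground N by apply: subset_trans (subsetIl _ _) sI.
rewrite -eJ (card_in_imset (sub_in2 (subsetP sIJ) injg)).
by apply: indep_rk (subsetIl _ _); rewrite hg // eJ.
Qed.

(** This replaces the bijection between subtypes by a function on all of [U], directed from N to M;
    [x0] is its value outside the ground set of N. *)
Lemma iso_fun x0 : matroid_iso M N -> x0 \in ground M ->
  exists g, [/\ {in ground N &, injective g}, g @: ground N = ground M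
    & forall I : {set U}, I \subset ground N ->
        (I \in indep N) = (g @: I \in indep M)].
Proof.
case=> phi [psi phiK psiK] h x0M.
pose g u := if insub u is Some y then val (psi y) else x0.
have gE y : g (val y) = val (psi y) by rewrite /g valK.
have gS u (hu : u \in ground N) : g u = val (psi (Sub u hu)) by rewrite -gE.
exists g; split.
- move=> u v hu hv; rewrite !gS // => /val_inj /(can_inj psiK) e.
  by have := congr1 val e.
- apply/setP=> x; apply/imsetP/idP=> [[u hu ->]|hx].
    by rewrite gS; exact: valP.
  exists (val (phi (Sub x hx))); first exact: valP.
  by rewrite gE phiK.
move=> I sI.
pose J := [set x | val (phi x) \in I].
have eI : val @: (phi @: J) = I.
  apply/setP=> u; apply/imsetP/idP=> [[y /imsetP[x]]|uI].
    by rewrite inE => hx -> ->.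
  have hu := subsetP sI u uI.
  exists (Sub u hu) => //; apply/imsetP; exists (psi (Sub u hu)).
    by rewrite inE psiK.
  by rewrite psiK.
have -> : g @: I = val @: J.
  rewrite -[in LHS]eI -!imset_comp.
  by apply: eq_imset => x /=; rewrite gE phiK.
by rewrite h eI.
Qed.

Lemma fun_iso g : {in ground N &, injective g} -> g @: ground N = ground M ->
  (forall I : {set U}, I \subset ground N ->
     (I \in indep N) = (g @: I \in indep M)) ->
  matroid_iso M N.
Proof.
move=> injg eg h.
have hg (y : {y | y \in ground N}) : g (val y) \in ground M.
  by rewrite -eg imset_f // (valP y).
pose psi (y : {y | y \in ground N}) : {x | x \in ground M} := exist (fun x => x \in ground M) _ (hg y).
have injpsi : injective psi.
  move=> y z /(congr1 val) /= e; apply: val_inj.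
  by apply: injg e; exact: valP.
have [|phi psiK phiK] := inj_card_bij injpsi.
  by rewrite !card_sig /= -(card_in_imset injg) eg.
exists phi; first by exists psi.
move=> I; rewrite h; last by apply/subsetP=> _ /imsetP[y _ ->]; exact: valP.
have -> // : val @: I = g @: (val @: (phi @: I)).
rewrite -!imset_comp; apply: eq_imset => x /=.
by rewrite -[g _]/(val (psi (phi x))) phiK.
Qed.

(* An N-minor of M contracting C, with ground set the image of N under g. *)
Definition embeds g C :=
  [/\ {in ground N &, injective g}, g @: ground N \subset ground M,
      C \subset ground M, [disjoint C & g @: ground N]
    & forall I : {set U}, I \subset ground N ->
        rk M (g @: I :|: C) = rk N I + rk M C].

(** The deleted set does not affect the ranks of surviving sets, so the contracted set alone
    describes the minor. *)
Lemma minor_rk (M' : matroid T) : is_minor M' M ->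
  exists C, [/\ ground M' \subset ground M, C \subset ground M,
    [disjoint C & ground M'] & forall Y : {set T}, Y \subset ground M' ->
      rk M (Y :|: C) = rk M' Y + rk M C].
Proof.
case=> C [D [sC sD dCD ->]]; exists C; rewrite /=; split=> //.
- by rewrite setDDl subsetDl.
- by rewrite disjoint_sym disjoints_subset; apply/subsetP=> x; rewrite !inE => /and3P[].
move=> Y; rewrite subsetD => /andP[_ dY].
by rewrite rk_deletion (setDidPl dY) rk_contraction.
Qed.

End Isomorphisms.

Section Embeddings.

Variables (U T : finType) (N : matroid U) (M : matroid T).
Implicit Types (g : U -> T) (C : {set T}).

Lemma minor_embeds (M' : matroid T) : 0 < #|ground M'| ->
  is_minor M' M -> matroid_iso M' N ->
  exists g C, embeds N M g C /\ g @: ground N = ground M'.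
Proof.
move=> /card_gt0P[x0 x0M'] /minor_rk[C [sM' sC dC hC]] iso.
have [g [injg eg h]] := iso_fun iso x0M'.
exists g, C; split=> //; split; rewrite ?eg // => I sI.
by rewrite hC ?(rk_iso injg h) // -eg imsetS.
Qed.

Lemma embeds_minor g C : embeds N M g C ->
  exists M', [/\ is_minor M' M, matroid_iso M' N & ground M' = g @: ground N].
Proof.
case=> injg sg sC dC h.
have sgC : g @: ground N \subset ground M :\: C by rewrite subsetD sg disjoint_sym.
(* Everything outside [C] and the image of [g] is deleted. *)
pose D := ground M :\: C :\: g @: ground N.
have gM' : ground M :\: C :\: D = g @: ground N.
  by rewrite /D setDDr setDv set0U; exact/setIidPr.
exists (deletion (contraction M C) D); split=> //.
  exists C, D; split=> //.
    by rewrite /D setDDl subsetDl.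
  rewrite disjoint_sym disjoints_subset /D; apply/subsetP=> x.
  by rewrite !inE => /and3P[].
apply: (fun_iso injg) => // I sI.
have sgI : g @: I \subset g @: ground N by exact: imsetS.
rewrite indep_deletion indep_contraction // (subset_trans sgI sgC) /=.
have -> : [disjoint g @: I & D].
  apply: disjointWl sgI _; rewrite disjoint_sym disjoints_subset /D.
  by apply/subsetP=> x; rewrite !inE => /andP[].
rewrite andbT h // eqn_add2r indepE (card_in_imset (sub_in2 (subsetP sI) injg)).
by [].
Qed.

(** When [C] is independent, independence in the contraction is independence together with [C], so
    no ranks need be computed. The embeddings into sparse paving matroids and 2-sums are checked in
    this form. *)
Lemma embeds_indep g C : {in ground N &, injective g} ->
  g @: ground N \subset ground M -> C \in indep M ->
  [disjoint C & g @: ground N] ->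
  (forall I : {set U}, I \subset ground N ->
     (I \in indep N) = (g @: I :|: C \in indep M)) ->
  embeds N M g C.
Proof.
move=> injg sg hC dC h; split=> //; first exact: indep_sub.
have sC := indep_sub hC.
move=> I sI; rewrite -rk_contraction //; congr (_ + _).
pose M' := deletion (contraction M C) (ground M :\: g @: ground N).
have sgI (J : {set U}) : J \subset ground N -> g @: J \subset g @: ground N by exact: imsetS.
have dgI (J : {set U}) : J \subset ground N -> [disjoint g @: J & ground M :\: g @: ground N].
  move=> sJ; apply: disjointWl (sgI _ sJ) _; rewrite disjoint_sym disjoints_subset.
  by apply/subsetP=> x; rewrite !inE => /andP[].
rewrite -[RHS](@rk_iso _ _ N M' g) // => [|J sJ].
  by rewrite rk_deletion (setDidPl (dgI _ sI)).
rewrite h // indep_deletion dgI // andbT indep_contraction // subsetD.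
rewrite (subset_trans (sgI _ sJ) sg) /= disjoint_sym.
have dCJ : [disjoint C & g @: J] by apply: disjointWr (sgI _ sJ) dC.
move: hC; rewrite dCJ !indepE => /eqP->; rewrite cardsU setIC.
by rewrite (disjoint_setI0 dCJ) cards0 subn0.
Qed.

Lemma conn_elim e f : matroid_connected N M -> e \in ground M ->
  f \in ground M -> e != f ->
  exists g C, [/\ embeds N M g C, e \in g @: ground N & f \in g @: ground N].
Proof.
case=> _ h he hf nef; have [M' [minM' iso uM']] := h e f he hf nef.
have [eM' fM'] : e \in ground M' /\ f \in ground M'.
  by move: uM'; rewrite /uses subUset !sub1set => /andP.
have [|g [C [hg eg]]] := minor_embeds _ minM' iso; first by apply/card_gt0P; exists e.
by exists g, C; rewrite eg.
Qed.

Lemma conn_intro : 2 <= #|ground M| ->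
  (forall e f, e \in ground M -> f \in ground M -> e != f ->
     exists g C, [/\ embeds N M g C, e \in g @: ground N & f \in g @: ground N]) ->
  matroid_connected N M.
Proof.
move=> cM h; split=> // e f he hf nef; have [g [C [hg eg fg]]] := h e f he hf nef.
have [M' [minM' iso eM']] := embeds_minor hg.
by exists M'; split=> //; rewrite /uses eM' subUset !sub1set eg.
Qed.

End Embeddings.

(** * Duality for minors and N-connectivity *)

Section Duality.

Variables (U T : finType) (N : matroid U) (M : matroid T).

(** Dualizing exchanges the contracted set and the deleted set. *)
Lemma dual_minor (M' : matroid T) : is_minor M' M -> is_minor (dual M') (dual M).
Proof.
case=> C [D [sC sD dCD ->]]; exists D, C; split=> //; first by rewrite disjoint_sym.
apply: matroid_eq; first by rewrite /= !setDDl setUC.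
set E := ground M.
have e2 : ground (deletion (contraction M C) D) = E :\: (D :|: C).
  by rewrite /= setDDl setUC.
apply/setP=> I; rewrite indep_dual e2 indep_deletion indep_contraction //=.
rewrite -setDDl subsetD -/E; have [dIC|] := boolP [disjoint I & C]; last by rewrite !andbF.
rewrite !andbT; have [sI|] //= := boolP (I \subset E :\: D).
have [sIE dID] : I \subset E /\ [disjoint I & D] by apply/andP; rewrite -subsetD.
rewrite !rk_deletion -(eqn_add2r (rk M C)) !rk_contraction //.
have -> : E :\: D :\: C :\: I :\: D :|: C = E :\: (I :|: D).
  apply/setP=> x; rewrite !inE; have [xC|] := boolP (x \in C); last first.
    by case: (x \in E); case: (x \in D); case: (x \in I).
  rewrite (subsetP sC) // orbT (disjointFr dCD) //.
  by rewrite (disjointFl dIC).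
have -> : E :\: D :\: C :\: D :|: C = E :\: D.
  apply/setP=> x; rewrite !inE; have [xC|] := boolP (x \in C); last first.
    by case: (x \in E); case: (x \in D).
  by rewrite (subsetP sC) // orbT (disjointFr dCD).
have sIDE : I :|: D \subset E by rewrite subUset sIE.
have := rk_dual sIDE; have := rk_dual sD; rewrite -/E cardsU (disjoint_setI0 dID) cards0 subn0.
by move=> *; apply/eqP/eqP; lia.
Qed.

Lemma dual_iso : 0 < #|ground M| -> matroid_iso M N -> matroid_iso (dual M) (dual N).
Proof.
move=> /card_gt0P[x0 x0M] iso; have [g [injg eg h]] := iso_fun iso x0M.
apply: (@fun_iso _ _ (dual N) (dual M) g) => // I sI; rewrite !indep_dual sI -eg imsetS //=.
have -> : g @: ground N :\: g @: I = g @: (ground N :\: I).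
  apply/setP=> y; rewrite inE; apply/andP/imsetP=> [[yI /imsetP[x xN ey]]|[x]].
    by exists x => //; rewrite inE xN andbT; apply: contra yI => xI; rewrite ey imset_f.
  rewrite inE => /andP[xI xN] ->; split; last by rewrite imset_f.
  apply/imsetP=> -[z zI /injg e]; move: xI.
  by rewrite e ?zI // (subsetP sI).
by rewrite !(rk_iso injg h) // subsetDl.
Qed.

End Duality.

Lemma dual_conn (U T : finType) (N : matroid U) (M : matroid T) :
  matroid_connected N M -> matroid_connected (dual N) (dual M).
Proof.
case=> cM h; split=> // e f he hf nef.
have [M' [minM' iso uM']] := h e f he hf nef; exists (dual M'); split=> //.
  exact: dual_minor.
apply: dual_iso iso; apply/card_gt0P; exists e.
by move: uM'; rewrite /uses subUset !sub1set => /andP[].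
Qed.

Definition minor_hereditary (U : finType) (N : matroid U) : Prop :=
  forall (T : finType) (M : matroid T),
    matroid_connected N M -> #|ground N| < #|ground M| ->
    forall e : T, e \in ground M ->
      matroid_connected N (deletion M [set e]) \/
      matroid_connected N (contraction M [set e]).

(** The hypothesis for N is applied to the dual of M; its two alternatives come back exchanged. *)
Lemma dual_hereditary (U : finType) (N : matroid U) :
  minor_hereditary N -> minor_hereditary (dual N).
Proof.
move=> hN T M cM lt e he.
have cM' : matroid_connected N (dual M) by rewrite -[N]dualK; exact: dual_conn.
have [c|c] := hN T (dual M) cM' lt e he; [right|left].
  exact: (dual_conn c).
by have := dual_conn c; rewrite dualK dualK.
Qed.

(** Elements outside [X] are removed one at a time, each by whichever of deletion and contraction
    keeps the matroid N-connected. Once |E(M)| is down to |E(N)|, the N-minor through any pair has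
    all of E(M) as its ground set. *)
Lemma hereditary_embeds (U T : finType) (N : matroid U) (M : matroid T)
    (X : {set T}) :
  minor_hereditary N -> 2 <= #|ground N| -> matroid_connected N M ->
  X \subset ground M -> #|X| = #|ground N| ->
  exists g C, embeds N M g C /\ g @: ground N = X.
Proof.
move=> hN cN; have [n] := ubnP #|ground M|; elim: n => // n IHn in M *.
move=> ltn cM sX eX; have [le|lt] := leqP #|ground M| #|ground N|.
  have /card_gt1P[e [f [he hf nef]]] := cM.1.
  have [g [C [hg _ _]]] := conn_elim cM he hf nef; exists g, C; split=> //.
  have [injg sg _ _ _] := hg.
  have /eqP -> : g @: ground N == ground M by rewrite eqEcard sg card_in_imset.
  by apply/esym/eqP; rewrite eqEcard sX eX.
have /subsetPn[e he eX'] : ~~ (ground M \subset X).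
  by apply/negP=> /subset_leq_card; rewrite leqNgt eX lt.
have se : [set e] \subset ground M by rewrite sub1set.
have cE : #|ground M :\: [set e]| < n.
  by rewrite -ltnS; apply: leq_trans ltn; rewrite ltnS [leqRHS](cardsD1 e) he.
have sXe : X \subset ground M :\: [set e] by rewrite subsetD1 sX.
case: (hN T M cM lt e he) => c.
  have [g [C [[injg sg sC dC h] eg]]] := IHn (deletion M [set e]) cE c sXe eX.
  exists g, C; split=> //; split=> //.
  - by apply: subset_trans sg (subsetDl _ _).
  - by apply: subset_trans sC (subsetDl _ _).
  move=> I sI; have := h I sI; rewrite !rk_deletion.
  have neC : e \notin C by apply/negP=> /(subsetP sC); rewrite !inE eqxx.
  have negI : e \notin g @: I.
    by apply: contra eX' => /(subsetP (imsetS g sI)); rewrite eg.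
  by rewrite !(setDidPl _) // disjoint_sym disjoints1 // inE negb_or negI.
(* After a contraction, [e] joins the contracted set. *)
have [g [C [[injg sg sC dC h] eg]]] := IHn (contraction M [set e]) cE c sXe eX.
exists g, (C :|: [set e]); split=> //; split=> //.
- by apply: subset_trans sg (subsetDl _ _).
- by rewrite subUset se andbT; apply: subset_trans sC (subsetDl _ _).
- by rewrite disjoint_sym disjoints_subset setCU subsetI -!disjoints_subset disjoint_sym dC eg disjoint_sym disjoints1.
move=> I sI; have := h I sI; have := rk_contraction (g @: I :|: C) se.
have := rk_contraction C se; rewrite -setUA; lia.
Qed.

(** * Pullbacks, sparse paving matroids, uniform matroids and twins *)

Lemma exists_subset_card (T : finType) (S Z : {set T}) n :
  S \subset Z -> #|S| <= n <= #|Z| ->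
  exists X : {set T}, [/\ S \subset X, X \subset Z & #|X| = n].
Proof.
move=> sSZ /andP[]; move: {2}(n - #|S|) (erefl (n - #|S|)) => m.
elim: m S sSZ => [|m IHm] S sSZ em leS leZ; first by exists S; split=> //; lia.
have /subsetPn[x xZ xS] : ~~ (Z \subset S) by apply/negP=> /subset_leq_card; lia.
have sxS : x |: S \subset Z by rewrite subUset sub1set xZ.
have [||//|X [sX sXZ eX]] := IHm (x |: S) sxS; rewrite ?cardsU1 ?xS; try lia.
by exists X; split=> //; apply: subset_trans sX; exact: subsetUr.
Qed.

Lemma exists_bij_on (U T : finType) (A : {set U}) (X : {set T}) :
  0 < #|X| -> #|A| = #|X| ->
  exists2 g : U -> T, {in A &, injective g} & g @: A = X.
Proof.
move=> /card_gt0P[x0 x0X] eAX.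
have eA : size (enum A) = size (enum X) by rewrite -!cardE.
pose g u := nth x0 (enum X) (index u (enum A)).
have ltA u : u \in A -> index u (enum A) < size (enum X).
  by move=> uA; rewrite -eA index_mem mem_enum.
have injg : {in A &, injective g}.
  move=> u v uA vA /eqP; rewrite nth_uniq ?enum_uniq ?ltA // => /eqP e.
  by apply: (index_inj u _ _ e); rewrite mem_enum.
exists g => //; apply/eqP; rewrite eqEcard card_in_imset // eAX leqnn andbT.
by apply/subsetP=> _ /imsetP[u uA ->]; rewrite -mem_enum mem_nth ?ltA.
Qed.

Section Pullback.

Variables (T U : finType) (N : matroid U) (pi : T -> U) (E : {set T}).

(** Elements of [E] with the same image under [pi] become parallel, or loops if that image is not
    independent; this is how parallel classes are enlarged. *)
Definition pullback_indep :=
  [set I : {set T} | [&& I \subset E, #|pi @: I| == #|I| & pi @: I \in indep N]].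

Lemma pullback_axiom : matroid_axiom E pullback_indep.
Proof.
apply/matroid_axiomP; split.
- by move=> I; rewrite inE => /andP[].
- by rewrite inE sub0set imset0 !cards0 indep0.
- move=> I J; rewrite !inE => /and3P[sJ /imset_injP injJ hJ] sIJ.
  rewrite (subset_trans sIJ sJ) (indepS hJ (imsetS _ sIJ)) andbT.
  by apply/imset_injP; apply: sub_in2 injJ; exact: subsetP.
move=> I J; rewrite !inE => /and3P[sI /eqP eI hI] /and3P[sJ /eqP eJ hJ] lt.
have [|y /setDP[/imsetP[x xJ ->] yI] hy] := indep_aug hI hJ; first by rewrite eI eJ.
have xI : x \notin I by apply: contra yI; exact: imset_f.
exists x; rewrite inE ?xI // imsetU1 hy subUset sub1set sI (subsetP sJ) //.
by rewrite !cardsU1 yI xI eI eqxx.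
Qed.

Definition pullback : matroid T := Matroid pullback_axiom.

Lemma rk_pullback (S : {set T}) : S \subset E -> rk pullback S = rk N (pi @: S).
Proof.
move=> sS; apply/eqP; rewrite eqn_leq; apply/andP; split; apply/rk_leP=> I.
  by rewrite inE => /and3P[_ /eqP <- hI] sI; apply: indep_rk => //; exact: imsetS.
(* [s] chooses one preimage in [S] for each element, so that [J] is mapped bijectively onto [I]. *)
move=> hI sI; pose s y := [pick x in S | pi x == y].
pose J := [set x in S | (pi x \in I) && (s (pi x) == Some x)].
have sJ : J \subset S by apply/subsetP=> x; rewrite inE => /andP[].
have injJ : {in J &, injective pi}.
  move=> x y; rewrite !inE => /and3P[_ _ /eqP ex] /and3P[_ _ /eqP ey] e.
  by move: ex; rewrite e ey => -[].
have eJ : pi @: J = I.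
  apply/setP=> y; apply/imsetP/idP=> [[x]|yI]; first by rewrite inE => /and3P[_ ? _] ->.
  have /imsetP[x xS ey] := subsetP sI y yI.
  case es: (s y) => [z|]; last first.
    by move: es; rewrite /s; case: pickP => // /(_ x); rewrite xS ey eqxx.
  have [zS ez] : z \in S /\ pi z = y.
    by move: es; rewrite /s; case: pickP => // w /andP[? /eqP ?] [<-].
  by exists z; rewrite ?inE ?zS ?ez ?es ?yI /=.
rewrite -eJ card_in_imset //; apply: indep_rk => //.
by rewrite inE (subset_trans sJ sS) card_in_imset // eqxx eJ.
Qed.

End Pullback.

Section SparsePaving.

Variables (T : finType) (E : {set T}) (r : nat) (H : {set {set T}}).

(** A sparse paving matroid: the members of [H] are circuits imposed on an otherwise uniform matroid
    of rank [r]. *)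
Definition sparse_indep := [set I : {set T} | [&& I \subset E, #|I| <= r & I \notin H]].

(** The last hypothesis says that distinct members of [H] share at most r - 2 elements. If no
    element of J - I augments [I], each of them completes [I] to a member of [H], so there is only
    one, and [J] itself is that member. *)
Lemma sparse_axiom : 0 < r -> {in H, forall A : {set T}, #|A| = r} ->
  (forall (A : {set T}) x y, x \notin A -> y \notin A ->
     x |: A \in H -> y |: A \in H -> x = y) ->
  matroid_axiom E sparse_indep.
Proof.
move=> r0 cH eH; apply/matroid_axiomP; split.
- by move=> I; rewrite inE => /andP[].
- rewrite inE sub0set cards0 /=; apply/negP=> /cH; rewrite cards0; lia.
- move=> I J; rewrite !inE => /and3P[sJ leJ hJ] sIJ.
  rewrite (subset_trans sIJ sJ) (leq_trans (subset_leq_card sIJ) leJ) /=.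
  apply: contra hJ => hI; have /eqP <- // : I == J.
  by rewrite eqEcard sIJ (cH I).
move=> I J; rewrite !inE => /and3P[sI leI hI] /and3P[sJ leJ hJ] lt.
have hx x : x \in J :\: I -> (x |: I \subset E) && (#|x |: I| <= r).
  rewrite inE => /andP[xI xJ]; rewrite subUset sub1set sI (subsetP sJ) //=.
  by rewrite cardsU1 xI (leq_trans _ leJ).
have [/existsP[x /andP[xJI xH]]|/existsPn none] :=
  boolP [exists x, (x \in J :\: I) && (x |: I \notin H)].
  by exists x => //; rewrite inE andbA hx.
have allH x : x \in J :\: I -> x |: I \in H.
  by move=> xJI; have := none x; rewrite xJI negbK.
have /subsetPn[x xJ xI] : ~~ (J \subset I).
  by apply/negP=> /subset_leq_card; rewrite leqNgt lt.
have xJI : x \in J :\: I by rewrite inE xI.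
have sJ' : J \subset x |: I.
  apply/subsetP=> y yJ; rewrite !inE; have [yI|yI] := boolP (y \in I); first by rewrite orbT.
  have yJI : y \in J :\: I by rewrite inE yI.
  by rewrite (eH I x y xI yI (allH x xJI) (allH y yJI)) eqxx.
have e : J == x |: I by rewrite eqEcard sJ' cardsU1 xI.
by move: hJ; rewrite (eqP e) allH.
Qed.

End SparsePaving.

Section Uniform.

Variables (T : finType) (M : matroid T) (r : nat).
Hypothesis hM : forall I : {set T}, I \subset ground M -> (I \in indep M) = (#|I| <= r).

Lemma rk_uniform_like (S : {set T}) : S \subset ground M -> rk M S = minn r #|S|.
Proof.
move=> sS; apply/eqP; rewrite eqn_leq; apply/andP; split.
  by apply/rk_leP=> I hI sI; rewrite leq_min -hM ?hI ?indep_sub // subset_leq_card.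
have [||X [_ sX eX]] := @exists_subset_card T set0 S (minn r #|S|); rewrite ?sub0set //.
  by rewrite cards0 geq_minr.
by rewrite -eX indep_rk // hM ?(subset_trans sX) // eX geq_minl.
Qed.

End Uniform.

Section UniformLike.

Variables (T : finType) (M : matroid T).

Lemma iso_uniform n r : 0 < n -> #|ground M| = n ->
  (forall I : {set T}, I \subset ground M -> (I \in indep M) = (#|I| <= r)) ->
  matroid_iso M (uniform r n).
Proof.
move=> n0 cM hM.
have [||g injg eg] := @exists_bij_on 'I_n T [set: 'I_n] (ground M).
- by rewrite cM.
- by rewrite cardsT card_ord cM.
apply: (@fun_iso _ _ (uniform r n) M g) => // I _; rewrite hM ?inE; last by rewrite -eg imsetS ?subsetT.
by rewrite card_in_imset // => x y _ _; apply: injg; rewrite inE.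
Qed.

Lemma dual_uniform r : r <= #|ground M| ->
  (forall I : {set T}, I \subset ground M -> (I \in indep M) = (#|I| <= r)) ->
  forall I : {set T}, I \subset ground M ->
    (I \in indep (dual M)) = (#|I| <= #|ground M| - r).
Proof.
move=> ler hM I sI; rewrite indep_dual sI /= !(rk_uniform_like hM) ?subsetDl //.
have := cardsD (ground M) I; rewrite (setIidPr sI).
have := subset_leq_card sI => ? ?.
by apply/eqP/idP; lia.
Qed.

End UniformLike.

Section Twins.

Variables (T : finType) (M : matroid T).

(** As singletons have rank at most 1, the two equations say that [u] and [v] are both loops or are
    parallel; the rank form treats both cases at once. *)
Definition twin (u v : T) :=
  [/\ u \in ground M, v \in ground M, u != v,
      rk M [set u] = rk M [set u; v] & rk M [set v] = rk M [set u; v]].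

Lemma twin_sym u v : twin u v -> twin v u.
Proof. by case=> hu hv nuv e1 e2; split; rewrite 1?eq_sym // setUC. Qed.

Lemma twin_rk u v (J : {set T}) : twin u v -> u \in J -> rk M (v |: J) = rk M J.
Proof.
case=> _ _ _ e1 _ uJ; apply/eqP; rewrite eqn_leq (rkS M (subsetUr _ J)) andbT.
have := @rk_submod _ M J [set u; v] (v |: J) [set u]; rewrite e1 leq_add2r; apply.
  apply/subsetP=> x; rewrite !inE => /orP[->|->] //; by rewrite !orbT.
by rewrite sub1set !inE uJ eqxx.
Qed.

(** An independent set cannot contain two twins, so the rank is at most 1; and all singletons have
    the same rank. *)
Lemma twin_all_uniform : 2 <= #|ground M| ->
  (forall u v, u \in ground M -> v \in ground M -> u != v -> twin u v) ->
  exists2 r, r <= 1 & forall I : {set T}, I \subset ground M ->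
    (I \in indep M) = (#|I| <= r).
Proof.
move=> /card_gt1P[u [v [hu hv nuv]]] h.
have rk1 x : x \in ground M -> rk M [set x] = rk M [set u].
  move=> hx; have [-> //|nx] := eqVneq x u.
  by case: (h x u hx hu nx) => _ _ _ -> ->.
exists (rk M [set u]); first by rewrite -(cards1 u) rk_card.
move=> I sI; have [->|[x xI]] := set_0Vmem I; first by rewrite indep0 cards0.
have hx := subsetP sI x xI.
have rkI : rk M I = rk M [set u].
  have sx : [set x] \subset I by rewrite sub1set.
  apply/eqP; rewrite eqn_leq -{2}(rk1 x hx) (rkS M sx) andbT.
  have [K [hK sK <-]] := rk_basis M I.
  have [->|[y yK]] := set_0Vmem K; first by rewrite cards0.
  have hy : y \in ground M by apply: (subsetP sI); apply: (subsetP sK).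
  have : [set y] \in indep M by apply: indepS hK _; rewrite sub1set.
  rewrite indepE rk1 // cards1 => /eqP ->; rewrite leqNgt; apply/negP.
  move/card_gt1P=> [z [w [zK wK nzw]]].
  have hz : z \in ground M by apply: (subsetP sI); apply: (subsetP sK).
  have hw : w \in ground M by apply: (subsetP sI); apply: (subsetP sK).
  have : [set z; w] \in indep M by apply: indepS hK _; rewrite subUset !sub1set zK.
  rewrite indepE cards2 nzw; case: (h z w hz hw nzw) => _ _ _ <- _.
  by have := rk_card M [set z]; rewrite cards1; case: rk => [|[]].
rewrite indepE rkI; have := rk_card M I; rewrite rkI => le.
by rewrite eqn_leq le.
Qed.

End Twins.

(** * Matroids with twins *)

(** In [M] the pair [p], [q] is replaced by |E(N)| copies [inr y] of [p]. Any two copies can play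
    [p] and [q], so [M] is N-connected, and an N-minor living on the copies alone makes all pairs of
    N twins. *)
Lemma twin_hereditary (U : finType) (N : matroid U) (p q : U) :
  minor_hereditary N -> twin N p q ->
  forall u v, u \in ground N -> v \in ground N -> u != v -> twin N u v.
Proof.
move=> hN tw; have [hp hq npq _ _] := tw.
have cN : 2 <= #|ground N| by apply/card_gt1P; exists p, q.
pose pi (t : U + U) := if t is inl u then u else p.
pose E : {set U + U} := inl @: (ground N :\: [set p; q]) :|: inr @: ground N.
pose M := pullback N pi E.
have sR : inr @: ground N \subset E by exact: subsetUr.
have rkM (S : {set U + U}) : S \subset E -> rk M S = rk N (pi @: S) by exact: rk_pullback.
pose g y y' u : U + U := if u == p then inr y else if u == q then inr y' else inl u.
have emb y y' : y \in ground N -> y' \in ground N -> y != y' -> embeds N M (g y y') set0.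
  move=> hy hy' nyy'.
  have gE (u : U) : u \in ground N -> g y y' u \in E.
    move=> hu; rewrite /g /E inE; case: eqVneq => [_|up].
      by rewrite (imset_f _ hy) orbT.
    case: eqVneq => [_|uq]; first by rewrite (imset_f _ hy') orbT.
    by rewrite imset_f // !inE negb_or up uq.
  have sg (I : {set U}) : I \subset ground N -> g y y' @: I \subset E.
    by move=> sI; apply/subsetP=> _ /imsetP[u uI ->]; apply/gE/(subsetP sI).
  split; rewrite ?sg ?sub0set ?disjoints0 //.
  - move=> u v _ _; rewrite /g.
    by case: eqVneq => [eu|_]; [|case: eqVneq => [eu|_]];
      (case: eqVneq => [ev|_]; [|case: eqVneq => [ev|_]]) => //;
      [ rewrite eu ev | case=> e; move: nyy'; rewrite e eqxx
      | case=> e; move: nyy'; rewrite e eqxx | rewrite eu ev | case].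
  - by rewrite -setI_eq0 set0I.
  (* Composed with [pi], the map [g y y'] sends [q] to [p] and fixes the rest; replacing [q] by its
     twin [p] does not change the rank. *)
  move=> I sI; rewrite rk0 addn0 setU0 rkM ?sg //.
  have pig u : pi (g y y' u) = if u == q then p else u.
    rewrite /g; case: eqVneq => [->|_] /=; last by case: eqVneq.
    by rewrite (negbTE npq).
  have [qI|qI] := boolP (q \in I); last first.
    congr (rk N _); rewrite -imset_comp; apply/setP=> u.
    apply/imsetP/idP=> [[v vI]|uI].
      by rewrite /= pig; case: eqVneq => [e|_ -> //]; rewrite -e vI in qI.
    by exists u; rewrite //= pig; case: eqVneq => // e; rewrite -e uI in qI.
  have eI : pi @: (g y y' @: I) = p |: (I :\ q).
    rewrite -imset_comp; apply/setP=> u; rewrite !inE; apply/imsetP/orP=> /=.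
      case=> v vI; rewrite pig; case: eqVneq => [_ ->|nvq ->]; first by left.
      by right; rewrite nvq.
    case=> [/eqP->|/andP[nuq uI]]; first by exists q; rewrite // pig eqxx.
    by exists u; rewrite // pig (negbTE nuq).
  rewrite eI -(twin_rk (twin_sym tw) qI) -[RHS](twin_rk tw (setU11 _ _)).
  rewrite -(twin_rk tw (setU11 _ _)); congr (rk N _).
  apply/setP=> u; rewrite !inE; case: eqVneq => [->|_] //=; by rewrite qI orbT.
have gM y : y \in ground N -> exists2 y', y' \in ground N & y != y'.
  move=> hy; have [->|n] := eqVneq y p; first by exists q.
  by exists p.
have cM : matroid_connected N M.
  apply: conn_intro.
    apply: leq_trans cN _; rewrite -(card_imset (ground N) (@inr_inj U U)).
    exact: subset_leq_card.
  have gp y y' : inr y \in g y y' @: ground N.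
    by apply/imsetP; exists p; rewrite // /g eqxx.
  have gq y y' : inr y' \in g y y' @: ground N.
    by apply/imsetP; exists q; rewrite // /g eq_sym (negbTE npq) eqxx.
  have gl y y' u : u \in ground N :\: [set p; q] -> inl u \in g y y' @: ground N.
    rewrite !inE negb_or => /andP[/andP[up uq] hu]; apply/imsetP; exists u => //.
    by rewrite /g (negbTE up) (negbTE uq).
  move=> _ _ /setUP[]/imsetP[u hu ->] /setUP[]/imsetP[v hv ->] nuv.
  - by exists (g p q), set0; split; [exact: emb | exact: gl | exact: gl].
  - have [v' hv' nv] := gM v hv; exists (g v v'), set0.
    by split; [exact: emb | exact: gl | exact: gp].
  - have [u' hu' nu] := gM u hu; exists (g u u'), set0.
    by split; [exact: emb | exact: gp | exact: gl].
  - exists (g u v), set0; split; [apply: emb => //; apply: contra nuv => /eqP-> // | exact: gp | exact: gq].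
have [|f [C [[injf sf sC dC hf] ef]]] := hereditary_embeds hN cN cM sR.
  by rewrite card_imset //; exact: inr_inj.
(* All of [I] is sent to copies of [p], so the right side does not depend on the nonempty set [I];
   singletons and pairs therefore have equal rank. *)
have key (I : {set U}) : I \subset ground N -> I != set0 -> rk N I + rk M C = rk N (p |: pi @: C).
  move=> sI /set0Pn[x xI]; rewrite -hf // rkM; last first.
    by rewrite subUset sC andbT; apply: subset_trans (imsetS _ sI) sf.
  congr (rk N _); rewrite imsetU; congr (_ :|: _); apply/setP=> z; rewrite inE.
  have fp u : u \in I -> pi (f u) = p.
    move=> uI; have : f u \in f @: ground N by rewrite imset_f // (subsetP sI).
    by rewrite ef => /imsetP[w _ ->].
  apply/imsetP/eqP=> [[_ /imsetP[u uI ->] ->]|->]; first exact: fp.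
  by exists (f x); rewrite ?imset_f ?fp.
move=> u v hu hv nuv; split=> //.
  have su : [set u] \subset ground N by rewrite sub1set.
  have suv : [set u; v] \subset ground N by rewrite subUset !sub1set hu.
  apply/eqP; rewrite -(eqn_add2r (rk M C)) !key //; apply/set0Pn; exists u; by rewrite !inE eqxx.
have su : [set v] \subset ground N by rewrite sub1set.
have suv : [set u; v] \subset ground N by rewrite subUset !sub1set hu.
by apply/eqP; rewrite -(eqn_add2r (rk M C)) !key //; apply/set0Pn; exists v; rewrite !inE eqxx ?orbT.
Qed.

(* Three parallel classes in rank 2: a rank-1 minor loses one of them. *)
Lemma hereditary_U1 (U : finType) (N : matroid U) :
  minor_hereditary N ->
  (forall I : {set U}, I \subset ground N -> (I \in indep N) = (#|I| <= 1)) ->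
  #|ground N| <= 2.
Proof.
move=> hN eN; rewrite leqNgt; apply/negP=> cN.
have cN2 : 2 <= #|ground N| by lia.
have [u0 hu0] : exists u0, u0 \in ground N by apply/card_gt0P; lia.
pose n := #|ground N|.
pose E := setX (ground N) [set: 'I_3]; pose M := pullback (uniform 2 3) snd E.
have rkM (S : {set U * 'I_3}) : S \subset E -> rk M S = minn 2 #|snd @: S|.
  move=> sS; rewrite rk_pullback // (@rk_uniform_like _ _ 2) //; last exact: subsetT.
  by move=> I _; rewrite inE.
have rkN (I : {set U}) : I \subset ground N -> rk N I = minn 1 #|I| by exact: rk_uniform_like.
have cM : matroid_connected N M.
  apply: conn_intro.
    rewrite cardsX cardsT card_ord; lia.
  move=> e f he hf nef.
  (* Contracting an element of a class [k] that avoids [e] and [f] merges the other two classes into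
     one parallel class, from which |E(N)| elements including [e] and [f] are taken. *)
  have [k nke nkf] : exists2 k : 'I_3, k != e.2 & k != f.2.
    have : 0 < #|~: [set e.2; f.2]|.
      by have := cardsC [set e.2; f.2]; rewrite cards2 card_ord; case: eqVneq; lia.
    by case/card_gt0P=> k; rewrite !inE negb_or => /andP[]; exists k.
  pose Z := setX (ground N) [set~ k].
  have sZE : Z \subset E by apply: setXS.
  have sef : [set e; f] \subset Z.
    move: he hf nke nkf; rewrite !inE; case: e {nef} => e1 e2; case: f => f1 f2 /=.
    rewrite !andbT => he hf ne nf; apply/subsetP=> x; rewrite !inE.
    by case/orP=> /eqP-> /=; rewrite ?he ?hf eq_sym.
  have [|X [sefX sXZ eX]] := @exists_subset_card _ _ Z n sef.
    by rewrite cards2 nef cardsX cardsC1 card_ord /n; lia.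
  have [||g injg eg] := @exists_bij_on _ _ (ground N) X; rewrite ?eX //; first by rewrite (leq_trans _ cN).
  exists g, [set (u0, k)].
  have /andP[eX' fX'] : (e \in X) && (f \in X) by rewrite -!sub1set -subUset.
  rewrite eg; split=> //; split=> //.
  - by rewrite eg (subset_trans sXZ).
  - by rewrite sub1set !inE hu0.
  - by rewrite eg disjoints1; apply/negP=> /(subsetP sXZ); rewrite !inE eqxx andbF.
  move=> I sI; rewrite !rkM ?rkN ?imset_set1 ?cards1 //; last 2 first.
  - by rewrite sub1set !inE hu0.
  - rewrite subUset sub1set !inE hu0 andbT /= (subset_trans (imsetS g sI)) //.
    by rewrite eg (subset_trans sXZ).
  have [->|[u uI]] := set_0Vmem I; first by rewrite imset0 set0U cards0 imset_set1 cards1.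
  have : 0 < #|I| by apply/card_gt0P; exists u.
  have : 1 < #|snd @: (g @: I :|: [set (u0, k)])|.
    apply/card_gt1P; exists (g u).2, k; split.
    - by rewrite imset_f // inE imset_f.
    - by rewrite -[k]/((u0, k).2) imset_f // !inE eqxx orbT.
    have : g u \in Z by rewrite (subsetP sXZ) // -eg imset_f // (subsetP sI).
    by rewrite !inE => /andP[].
  by move=> /minn_idPl -> /minn_idPl ->.
(* [X] is made to meet all three classes, which is possible because |E(N)| is at least 3. *)
pose S := setX [set u0] [set: 'I_3].
have sSE : S \subset E by apply: setXS; rewrite // sub1set.
have [|X [sSX sXE eX]] := @exists_subset_card _ S E n sSE.
  by rewrite !cardsX cards1 cardsT card_ord /n; lia.
have [g [C [[injg sg sC dC h] eg]]] := hereditary_embeds hN cN2 cM sXE eX.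
have inX k : exists2 x, x \in ground N & (g x).2 = k.
  have : (u0, k) \in X by apply: (subsetP sSX); rewrite !inE eqxx.
  by rewrite -eg => /imsetP[x hx e]; exists x; rewrite -?e.
have hE := h _ (subxx _); rewrite rkN // !rkM ?subUset ?sg // in hE.
have eT : snd @: (g @: ground N :|: C) = setT.
  apply/setP=> k; rewrite !inE; have [x hx <-] := inX k.
  by rewrite imset_f // inE imset_f.
rewrite eT cardsT card_ord in hE.
rewrite (minn_idPl (ltnW cN2)) in hE; case: hE => hE.
(* The rank of the minor forces [C] to have rank 1, hence to lie in one class [k]; the element of
   [X] in that class would be a loop of the minor. *)
have /cards1P[k ek] : #|snd @: C| == 1 by case: #|_| hE => [|[|[|?]]].
have [x hx exk] := inX k.
have sx : [set x] \subset ground N by rewrite sub1set.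
have := h _ sx; rewrite rkN // imset_set1 !rkM ?cards1 //; last first.
  by rewrite subUset sC sub1set (subsetP sg) // imset_f.
by rewrite imsetU imset_set1 exk ek setUid !cards1.
Qed.

(** The witness is a circuit [X] on |E(N)| elements plus the coloop [None], written as a sparse
    paving matroid in which [X] is the only dependent set of its size. *)
Lemma hereditary_free (U : finType) (N : matroid U) :
  minor_hereditary N ->
  (forall I : {set U}, I \subset ground N -> I \in indep N) ->
  #|ground N| <= 2.
Proof.
move=> hN eN; rewrite leqNgt; apply/negP=> cN.
have cN2 : 2 <= #|ground N| by lia.
have [u0 hu0] : exists u0, u0 \in ground N by apply/card_gt0P; lia.
pose n := #|ground N|; pose X : {set option U} := Some @: ground N.
have eX : #|X| = n by rewrite card_imset //; exact: Some_inj.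
have ax : matroid_axiom (None |: X) (sparse_indep (None |: X) n [set X]).
  apply: sparse_axiom; first by rewrite /n; lia.
    by move=> A; rewrite inE => /eqP->.
  move=> A x y xA yA; rewrite !inE => /eqP eA /eqP eA'.
  have : y \in x |: A by rewrite eA -eA' setU11.
  by rewrite !inE (negbTE yA) orbF => /eqP.
pose M := Matroid ax.
have cE : #|None |: X| = n.+1.
  by rewrite cardsU1 eX; case: imsetP => // -[].
have cM : matroid_connected N M.
  apply: conn_intro; first by rewrite /= cE /n; lia.
  move=> e f he hf nef.
  (* Deleting an element of the circuit leaves a free matroid; |E(N)| at least 3 provides one that
     is neither [e] nor [f]. *)
  have [z zX zef] : exists2 z, z \in X & z \notin [set e; f].
    have : 0 < #|X :\: [set e; f]|.
      have := cardsD X [set e; f]; have := subset_leq_card (subsetIr X [set e; f]).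
      by rewrite cards2 nef eX /n; lia.
    by case/card_gt0P=> z /setDP[]; exists z.
  pose Y := (None |: X) :\ z.
  have eY : #|ground N| = #|Y|.
    by have := cardsD1 z (None |: X); rewrite cE !inE zX orbT add1n => -[].
  have [|g injg eg] := exists_bij_on _ eY; first by rewrite -eY; lia.
  exists g, set0; rewrite eg /Y.
  move: zef he hf; rewrite !inE negb_or ![z == _]eq_sym => /andP[-> ->] -> ->; split=> //.
  apply: embeds_indep => //.
  - by rewrite eg /Y subsetDl.
  - exact: indep0.
  - by rewrite -setI_eq0 set0I.
  move=> I sI; rewrite eN // setU0 inE.
  have sgI : g @: I \subset Y by rewrite -eg imsetS.
  rewrite (subset_trans sgI) ?subsetDl //=.
  rewrite (leq_trans (subset_leq_card sgI)) -?eY // inE; apply/esym/eqP=> e'.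
  by have := subsetP sgI z; rewrite e' zX !inE eqxx => /(_ isT).
have sX : X \subset ground M by exact: subsetUr.
have [g [C [[injg sg sC dC h] eg]]] := hereditary_embeds hN cN2 cM sX eX.
(* A minor that is free on [X] gives [X] full rank already in [M], although [X] is a circuit. *)
have := h _ (subxx _); have := eN _ (subxx _); rewrite indepE => /eqP->.
rewrite eg => e; have := rkU M X C; rewrite e leq_add2r => le.
have : X \in indep M by rewrite indepE eqn_leq rk_card eX.
by rewrite inE inE eqxx !andbF.
Qed.

(** Twins force U_{0,n} or U_{1,n}. The second is bounded by [hereditary_U1]; the first has a free
    dual, bounded by [hereditary_free]. *)
Lemma twin_hereditary_uniform (U : finType) (N : matroid U) (p q : U) :
  minor_hereditary N -> twin N p q -> #|ground N| = 2 /\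
  exists2 r, r <= 1 & forall I : {set U}, I \subset ground N ->
    (I \in indep N) = (#|I| <= r).
Proof.
move=> hN tw; have [hp hq npq _ _] := tw.
have cN : 2 <= #|ground N| by apply/card_gt1P; exists p, q.
have [r r1 hr] := twin_all_uniform cN (twin_hereditary hN tw).
split; last by exists r.
apply/eqP; rewrite eqn_leq cN andbT.
case: r r1 hr => [|[|//]] _ hr; last exact: hereditary_U1 hN hr.
have := hereditary_free (dual_hereditary hN); apply=> I sI.
by rewrite (dual_uniform _ hr) ?subn0 ?subset_leq_card.
Qed.

(** * The whirl of rank 3 *)

(* The elements are the nonconstant Boolean triples, and the i-th nonspanning
   line consists of those with i-th coordinate true: the triples with two true
   coordinates are the corners of the triangle, the others lie inside its sides. *)
Definition whirl_type : finType := (bool * bool * bool)%type.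

Definition whirl_coord (i : 'I_3) (t : whirl_type) : bool :=
  nth false [:: t.1.1; t.1.2; t.2] i.

Definition whirl_ground : {set whirl_type} :=
  [set t | ~~ ((t.1.1 == t.1.2) && (t.1.2 == t.2))].

Definition whirl_line (i : 'I_3) : {set whirl_type} :=
  [set t in whirl_ground | whirl_coord i t].

Definition whirl_lines := [set whirl_line i | i : 'I_3].

Lemma card_whirl_line i : #|whirl_line i| = 3.
Proof.
pose s : seq whirl_type :=
  nth [::] [:: [:: (true, false, false); (true, true, false); (true, false, true)];
               [:: (false, true, false); (true, true, false); (false, true, true)];
               [:: (false, false, true); (true, false, true); (false, true, true)]] i.
have us : uniq s by rewrite /s; case: i {s} => [[|[|[|]]]].
rewrite -[RHS](_ : size s = 3); last by rewrite /s; case: i {s us} => [[|[|[|]]]].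
rewrite -(card_uniqP us); apply: eq_card => -[[x y] z].
by rewrite !inE /whirl_coord /s; case: i {s us} => [[|[|[|]]]] //= _; case: x; case: y; case: z.
Qed.

Lemma whirl_line_meet i j u v : i != j ->
  u \in whirl_line i -> u \in whirl_line j ->
  v \in whirl_line i -> v \in whirl_line j -> u = v.
Proof.
rewrite !inE /whirl_coord; case: u => [[x y] z]; case: v => [[x' y'] z'].
by case: i => [[|[|[|]]]] // ?; case: j => [[|[|[|]]]] // ? _;
   case: x; case: y; case: z; case: x'; case: y'; case: z'.
Qed.

Lemma whirl_line_card2 i j (A : {set whirl_type}) :
  A \subset whirl_line i -> A \subset whirl_line j -> 1 < #|A| -> i = j.
Proof.
move=> sAi sAj /card_gt1P[u [v [uA vA nuv]]]; apply/eqP/negPn/negP=> nij.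
move: nuv; rewrite (whirl_line_meet (u := u) (v := v) nij) ?eqxx //;
  by [apply: (subsetP sAi) | apply: (subsetP sAj)].
Qed.

Lemma whirl_axiom : matroid_axiom whirl_ground (sparse_indep whirl_ground 3 whirl_lines).
Proof.
apply: sparse_axiom => // [A /imsetP[i _ ->]|A x y xA yA]; first exact: card_whirl_line.
move=> /imsetP[i _ ei] /imsetP[j _ ej].
have eij : i = j.
  apply: (@whirl_line_card2 _ _ A); rewrite -?ei -?ej ?subsetUr //.
  by have := card_whirl_line i; rewrite -ei cardsU1 xA; lia.
have : y \in x |: A by rewrite ei eij -ej setU11.
by rewrite !inE (negbTE yA) orbF => /eqP.
Qed.

Definition whirl : matroid whirl_type := Matroid whirl_axiom.

Lemma whirl_indep (I : {set whirl_type}) : (I \in indep whirl) =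
  [&& I \subset whirl_ground, #|I| <= 3 & I \notin whirl_lines].
Proof. by rewrite inE. Qed.

Lemma whirl_indep2 (I : {set whirl_type}) :
  I \subset whirl_ground -> #|I| <= 2 -> I \in indep whirl.
Proof.
move=> sI leI; rewrite whirl_indep sI (leq_trans leI) //=.
by apply/imsetP=> -[i _ e]; move: leI; rewrite e card_whirl_line.
Qed.

Section LoopColoop.

Variables (U : finType) (N : matroid U) (l c : U).
Hypotheses (nlc : l != c) (gN : ground N = [set l; c]).
Hypothesis hN : forall I : {set U}, I \subset ground N -> (I \in indep N) = (l \notin I).

(** An N-minor on [a] and [b] makes exactly one of them a loop, so the two have different ranks over
    the contracted set, against the last hypothesis. *)
Lemma connected_no_clones (T : finType) (M : matroid T) a b :
  matroid_connected N M -> a \in ground M -> b \in ground M -> a != b ->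
  (forall C : {set T}, C \subset ground M -> a \notin C -> b \notin C ->
     rk M (a |: C) = rk M (b |: C)) -> False.
Proof.
move=> cM ha hb nab h; have [g [C [[injg sg sC dC hg] ga gb]]] := conn_elim cM ha hb nab.
have lN : l \in ground N by rewrite gN !inE eqxx.
have cN : c \in ground N by rewrite gN !inE eqxx orbT.
have s1 x : x \in ground N -> [set x] \subset ground N by rewrite sub1set.
have rl : rk N [set l] = 0.
  have := rk_card N [set l]; have := hN (s1 l lN); rewrite indepE cards1 !inE eqxx.
  by case: rk => [|[]].
have rc : rk N [set c] = 1.
  by have := hN (s1 c cN); rewrite indepE cards1 !inE nlc => /eqP.
have aC : a \notin C by rewrite (disjointFl dC).
have bC : b \notin C by rewrite (disjointFl dC).
have := hg _ (s1 l lN); have := hg _ (s1 c cN); rewrite rl rc !imset_set1.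
have e : rk M (a |: C) = rk M (b |: C) by exact: h.
have ab x : x \in g @: ground N -> x = g l \/ x = g c.
  by rewrite gN imsetU !imset_set1 !inE => /orP[]/eqP; [left|right].
move: nab e; case: (ab a ga) => ->; case: (ab b gb) => ->; rewrite ?eqxx // => _; clear; lia.
Qed.

(** Contracting the other two points of line [i] turns [e] into a loop, while [f], which is off that
    line, stays independent of them because distinct lines share at most one point. *)
Lemma whirl_embeds i (e f : whirl_type) :
  e \in whirl_line i -> f \in whirl_ground -> ~~ whirl_coord i f ->
  exists g C, [/\ embeds N whirl g C, e \in g @: ground N & f \in g @: ground N].
Proof.
move=> he hf nf; have [heE hi] : e \in whirl_ground /\ whirl_coord i e.
  by move: he; rewrite inE => /andP.
have fL : f \notin whirl_line i by rewrite inE negb_and nf orbT.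
have nef : e != f by apply: contra nf => /eqP<-.
pose C := whirl_line i :\ e; pose g u := if u == l then e else f.
have cC : #|C| = 2 by have := cardsD1 e (whirl_line i); rewrite he card_whirl_line add1n => -[].
have fC : f \notin C by rewrite inE (negbTE fL) andbF.
have sL : whirl_line i \subset whirl_ground by apply/subsetP=> u; rewrite inE => /andP[].
have sC : C \subset whirl_ground by apply: subset_trans (subsetDl _ _) sL.
have hfC : f |: C \in indep whirl.
  rewrite whirl_indep subUset sub1set hf sC cardsU1 fC cC /=.
  apply/imsetP=> -[j _ ej]; have eij : i = j.
    by apply: (@whirl_line_card2 _ _ C); rewrite ?subsetDl ?cC // -ej subsetUr.
  by move: fL; rewrite eij -ej setU11.
have egN : g @: ground N = [set e; f].
  by rewrite gN imsetU !imset_set1 /g eqxx eq_sym (negbTE nlc).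
exists g, C; rewrite egN !inE !eqxx orbT; split=> //; apply: embeds_indep.
- move=> u v; rewrite gN !inE /g => /orP[]/eqP-> /orP[]/eqP->;
  rewrite ?eqxx // eq_sym (negbTE nlc) // => e'; by rewrite e' eqxx in nef.
- by rewrite egN subUset !sub1set heE hf.
- by apply: whirl_indep2; rewrite ?cC.
- by rewrite egN disjoint_sym disjoints_subset subUset !sub1set !inE eqxx /= (negbTE nf) !andbF.
move=> I sI; rewrite hN //; have [lI|lI] := boolP (l \in I).
  apply/esym/negbTE/negP=> hI; have : whirl_line i \in indep whirl.
    apply: indepS hI _; apply/subsetP=> u uL.
    rewrite in_setU in_setD1 uL andbT.
    have [->|_] := eqVneq u e; last by rewrite orbT.
    by rewrite orbF; apply/imsetP; exists l; rewrite // /g eqxx.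
  by rewrite whirl_indep imset_f ?andbF.
apply/esym/(indepS hfC); rewrite setSU //; apply/subsetP=> _ /imsetP[u uI ->].
by rewrite /g; case: eqVneq => [e'|_]; [rewrite -e' uI in lI | rewrite inE].
Qed.

(** Distinct triples differ in a coordinate, so some line contains exactly one of them. *)
Lemma whirl_connected : matroid_connected N whirl.
Proof.
apply: conn_intro.
  by apply/card_gt1P; exists (true, false, false), (true, true, false); rewrite !inE.
move=> e f he hf nef.
have [i ni] : exists i, whirl_coord i e != whirl_coord i f.
  move: e f {he hf} nef => [[x y] z] [[x' y'] z'] n.
  have [ex|nx] := eqVneq x x'; last by exists ord0.
  have [ey|ny] := eqVneq y y'; last by exists (Ordinal (isT : 1 < 3)).
  have [ez|nz] := eqVneq z z'; last by exists (Ordinal (isT : 2 < 3)).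
  by rewrite ex ey ez eqxx in n.
case ei: (whirl_coord i e) ni; case fi: (whirl_coord i f) => // _.
  by apply: (@whirl_embeds i); rewrite ?fi // in_set ei andbT.
have [||//|g [C [? ? ?]]] := @whirl_embeds i f e; rewrite ?ei //.
  by rewrite in_set fi andbT.
by exists g, C.
Qed.

Lemma loop_coloop_not_hereditary : ~ minor_hereditary N.
Proof.
move=> hered; pose e : whirl_type := (true, true, false).
pose a : whirl_type := (true, false, false).
pose b : whirl_type := (true, false, true).
pose d : whirl_type := (false, true, false).
have he : e \in whirl_ground by rewrite inE.
have lt : #|ground N| < #|ground whirl|.
  rewrite gN cards2 nlc -(card_whirl_line ord0) subset_leq_card //.
  by apply/subsetP=> u; rewrite inE => /andP[].
have [cD|cC] := hered _ _ whirl_connected lt e he.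
  (* a and d are in series after deleting e: every line through one of them
     contains e. *)
  have half x y (C : {set whirl_type}) :
      y \in whirl_ground ->
      (forall i, y \in whirl_line i -> e \in whirl_line i) -> y != e ->
      e \notin C -> x \notin C -> y \notin C -> rk whirl (x |: C) <= rk whirl (y |: C).
    move=> hy hyL nye eC xC yC; apply/rk_leP=> I hI sI.
    have [xI|xI] := boolP (x \in I); last first.
      apply: indep_rk => //; apply/subsetP=> z zI; have := subsetP sI z zI.
      by rewrite !inE => /orP[/eqP ez|->]; [rewrite -ez zI in xI | rewrite orbT].
    have sJ : I :\ x \subset C.
      by apply/subsetP=> z; rewrite !inE => /andP[nz /(subsetP sI)]; rewrite !inE (negbTE nz).
    have yJ : y \notin I :\ x by apply: contra yC; exact: (subsetP sJ).
    have cJ : #|y |: I :\ x| = #|I| by rewrite cardsU1 yJ (cardsD1 x I) xI.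
    rewrite -cJ; apply: indep_rk; last by rewrite setUS.
    move: hI; rewrite !whirl_indep cJ => /and3P[sIE -> _].
    rewrite subUset sub1set hy (subset_trans (subsetDl _ _) sIE) /=.
    apply/imsetP=> -[i _ ei]; have : e \in y |: I :\ x.
      by rewrite ei hyL // -ei setU11.
    by rewrite in_setU1 eq_sym (negbTE nye) => /(subsetP sJ); rewrite (negbTE eC).
  apply: (@connected_no_clones _ _ a d cD); rewrite ?inE // => C sC aC dC.
  have eC : e \notin C by apply/negP=> /(subsetP sC); rewrite !inE.
  have sub x : x != e -> (x |: C) :\ e = x |: C.
    move=> nx; apply/setDidPl; rewrite disjoint_sym disjoints1.
    by rewrite in_setU1 negb_or eq_sym nx.
  rewrite !rk_deletion !sub //; apply/eqP; rewrite eqn_leq !half ?inE //;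
    by case=> [[|[|[|]]]] // ?; rewrite !inE /whirl_coord.
(* e, a, b is a line, so a and b are parallel after contracting e. *)
apply: (@connected_no_clones _ _ a b cC); rewrite ?inE // => C sC aC bC.
have se : [set e] \subset ground whirl by rewrite sub1set.
have sE x : x \in whirl_ground -> [set e; x] \subset whirl_ground by move=> hx; rewrite subUset !sub1set he.
have half x y (K : {set whirl_type}) : x \in whirl_ground -> x != e -> y != e -> x != y ->
    [set e; x; y] = whirl_line ord0 -> e \in K -> rk whirl (y |: K) <= rk whirl (x |: K).
  move=> hx nx ny nxy eL eK.
  have r2 : rk whirl [set e; x] = 2.
    apply/eqP; have : [set e; x] \in indep whirl by apply: whirl_indep2; rewrite ?sE // cards2; case: (_ != _).
    by rewrite indepE cards2 [e == x]eq_sym nx.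
  have r3 : rk whirl [set e; x; y] <= 2.
    rewrite eL; have := rk_card whirl (whirl_line ord0); have : whirl_line ord0 \notin indep whirl.
      by rewrite whirl_indep imset_f ?andbF.
    by rewrite indepE card_whirl_line; clear; lia.
  have sU : y |: K \subset (x |: K) :|: [set e; x; y].
    by rewrite subUset sub1set !inE eqxx !orbT /= setUC setUA subsetUr.
  have sI : [set e; x] \subset (x |: K) :&: [set e; x; y].
    by rewrite subUset !sub1set !inE !eqxx eK !orbT.
  by have := rk_submod whirl sU sI; rewrite r2; move: r3; clear; lia.
have L0 : [set e; a; b] = whirl_line ord0.
  by apply/setP=> -[[x y] z]; rewrite !inE /whirl_coord /=; case: x; case: y; case: z.
have L0' : [set e; b; a] = whirl_line ord0 by rewrite -L0 -!setUA [[set a] :|: _]setUC.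
apply/eqP; rewrite -(eqn_add2r (rk whirl [set e])) !rk_contraction // -!setUA.
by rewrite eqn_leq !half ?inE ?eqxx ?orbT.
Qed.

End LoopColoop.

(** * Circuits, components and 2-sums *)

Section Circuits.

Variables (T : finType) (M : matroid T).
Implicit Types D I J S X : {set T}.

Definition circuit D := minset [pred X : {set T} | (X \subset ground M) && (X \notin indep M)] D.

Lemma circuit_sub D : circuit D -> D \subset ground M.
Proof. by case/minsetP=> /andP[]. Qed.

Lemma circuit_dep D : circuit D -> D \notin indep M.
Proof. by case/minsetP=> /andP[]. Qed.

Lemma circuit_proper D x I : circuit D -> x \in D -> I \subset D :\ x -> I \in indep M.
Proof.
case/minsetP=> /andP[sD _] minD xD sI; apply/negPn/negP=> nI.
have sID := subset_trans sI (subsetDl D [set x]).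
have := minD I; rewrite /= nI (subset_trans sID sD) => /(_ isT sID) e.
by move: (subsetP sI x); rewrite e xD !inE eqxx => /(_ isT).
Qed.

Lemma dep_circuit X : X \subset ground M -> X \notin indep M ->
  exists2 D, circuit D & D \subset X.
Proof.
move=> sX nX.
have h : [pred X : {set T} | (X \subset ground M) && (X \notin indep M)] X by rewrite /= sX.
by have [D cD sDX] := minset_exists h; exists D.
Qed.

Lemma circuit_rk D x : circuit D -> x \in D -> rk M (D :\ x) = rk M D.
Proof.
move=> cD xD; have h : D :\ x \in indep M by exact: circuit_proper cD xD (subxx _).
have := circuit_dep cD; have := rk_card M D; have := rkS M (subsetDl D [set x]).
move: h; rewrite !indepE => /eqP->; have := cardsD1 x D; rewrite xD; lia.
Qed.

Lemma circuit_rkU1 D x S : circuit D -> x \in D -> D :\ x \subset S ->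
  rk M (x |: S) = rk M S.
Proof.
move=> cD xD sDS; apply/eqP; rewrite eqn_leq (rkS M (subsetUr _ S)) andbT.
have := @rk_submod _ M S D (x |: S) (D :\ x).
rewrite (circuit_rk cD xD) leq_add2r; apply; last by rewrite subsetI sDS subsetDl.
by rewrite subUset subsetUl sub1set inE xD orbT.
Qed.

Lemma rk_circuit p S : p \in ground M -> S \subset ground M ->
  p \notin S -> rk M (p |: S) = rk M S ->
  exists D, [/\ circuit D, p \in D & D \subset p |: S].
Proof.
move=> hp sS pS e; have [K [hK sK eK]] := rk_basis M S.
have npK : p |: K \notin indep M.
  apply/negP=> /indep_rk/(_ (setUS [set p] sK)).
  by rewrite cardsU1 e eK; case: (boolP (p \in K)) => [/(subsetP sK)|]; [rewrite (negbTE pS)|lia].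
have [|D cD sD] := dep_circuit _ npK; first by rewrite subUset sub1set hp (subset_trans sK).
exists D; split=> //; last by apply: subset_trans sD (setUS _ sK).
apply/negPn/negP=> pD; have := circuit_dep cD; rewrite (indepS hK) //.
apply/subsetP=> z zD; have := subsetP sD z zD; rewrite !inE.
by case: eqVneq => // ez; rewrite -ez zD in pD.
Qed.

(** Strong circuit elimination, by ranks: through [D2], which misses [p], the set [S] spans [d], and
    then through [D1] it spans [p], so [rk_circuit] applies. *)
Lemma circuit_elimination D1 D2 p d : circuit D1 -> circuit D2 ->
  d \in D1 -> d \in D2 -> p \in D1 -> p \notin D2 ->
  exists D, [/\ circuit D, p \in D & D \subset (D1 :|: D2) :\ d].
Proof.
move=> c1 c2 d1 d2 p1 p2; pose S := (D1 :|: D2) :\ d :\ p.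
have npd : p != d by apply: contra p2 => /eqP->.
have sE : D1 :|: D2 \subset ground M by rewrite subUset !circuit_sub.
have sS : S \subset D1 :|: D2 by apply/subsetP=> z; rewrite !inE => /and3P[].
have eS : p |: S = (D1 :|: D2) :\ d by rewrite setD1K // !inE npd p1.
have rd : rk M (d |: S) = rk M S.
  apply: (circuit_rkU1 c2 d2); apply/subsetP=> z; rewrite !inE => /andP[-> z2].
  by rewrite z2 orbT !andbT; apply: contra p2 => /eqP<-.
have rp : rk M (p |: (d |: S)) = rk M (d |: S).
  apply: (circuit_rkU1 c1 p1); apply/subsetP=> z; rewrite !inE => /andP[-> z1].
  by rewrite z1 /= andbT orbN.
have rpS : rk M (p |: S) = rk M S.
  apply/eqP; rewrite eqn_leq (rkS M (subsetUr _ S)) andbT -rd -rp rkS //.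
  by rewrite setUS // subsetUr.
have [|||D [cD pD sD]] := rk_circuit _ _ _ rpS.
- by rewrite (subsetP sE) // inE p1.
- exact: subset_trans sS sE.
- by rewrite !inE eqxx.
by exists D; rewrite -eS.
Qed.

(** Induction on |D1 :|: D2|. Eliminating a common element [d] gives [D3] through [p] and [D4]
    through [q]. If these meet, their union has lost [d]. Otherwise [D4] meets D1 - D2, and the
    union of [D1] and [D4] misses a point of [D3] in D2 - D1. *)
Lemma circuit_meet_trans D1 D2 p q : circuit D1 -> circuit D2 ->
  p \in D1 -> q \in D2 -> D1 :&: D2 != set0 ->
  exists D, [/\ circuit D, p \in D & q \in D].
Proof.
have [n] := ubnP #|D1 :|: D2|; elim: n => // n IHn in D1 D2 *.
rewrite ltnS => len c1 c2 p1 q2 /set0Pn[d /setIP[d1 d2]].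
have [q1|q1] := boolP (q \in D1); first by exists D1.
have [p2|p2] := boolP (p \in D2); first by exists D2.
have [D3 [c3 p3 s3]] := circuit_elimination c1 c2 d1 d2 p1 p2.
have [D4 [c4 q4 s4]] := circuit_elimination c2 c1 d2 d1 q2 q1.
rewrite setUC in s4.
have cd := cardsD1 d (D1 :|: D2); rewrite inE d1 /= in cd.
have [dis|meet] := eqVneq (D3 :&: D4) set0; last first.
  apply: (IHn D3 D4) => //.
  have : D3 :|: D4 \subset (D1 :|: D2) :\ d by rewrite subUset s3.
  by move/subset_leq_card/leq_ltn_trans; apply; rewrite cd in len.
(* A circuit avoiding [d] cannot lie inside the circuit [D'], whose proper subsets are
   independent. *)
have out D D' D'' : circuit D -> circuit D' -> D \subset (D' :|: D'') :\ d -> d \in D' ->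
    exists2 z, z \in D & (z \notin D') && (z \in D'').
  move=> cD cD' sD dD'.
  have /subsetPn[z zD zD'] : ~~ (D \subset D').
    apply/negP=> sDD'; have := circuit_dep cD; rewrite (circuit_proper cD' dD') //.
    by rewrite subsetD1 sDD'; apply/negP=> /(subsetP sD); rewrite !inE eqxx.
  by exists z => //; have := subsetP sD z zD; rewrite !inE zD' (negbTE zD') => /andP[].
have [z z3 /andP[z1 z2]] := out _ _ _ c3 c1 s3 d1.
have [w w4 /andP[w2 w1]] : exists2 w, w \in D4 & (w \notin D2) && (w \in D1).
  by apply: (out _ D2 D1) => //; rewrite setUC.
have z4 : z \notin D4.
  by apply/negP=> z4; have : z \in D3 :&: D4 by [rewrite inE z3]; rewrite dis inE.
apply: (IHn D1 D4) => //; last by apply/set0Pn; exists w; rewrite inE w1.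
apply: leq_trans len; apply: proper_card; apply/properP; split.
  by rewrite subUset subsetUl /=; apply: subset_trans s4 (subsetDl _ _).
by exists z; rewrite !inE ?z2 ?orbT // negb_or z1.
Qed.

(** The disjunct [y == p] covers the case where [p] is a coloop and lies in no circuit. *)
Definition component p :=
  [set y in ground M | (y == p) || [exists D : {set T}, [&& circuit D, p \in D & y \in D]]].

Lemma componentP p y : reflect (y = p /\ p \in ground M \/
    exists D, [/\ circuit D, p \in D & y \in D]) (y \in component p).
Proof.
rewrite inE; apply: (iffP andP) => [[yE /orP[/eqP e|/existsP[D /and3P[]]]]|].
- by left; rewrite -e.
- by right; exists D.
case=> [[-> ->]|[D [cD pD yD]]]; first by rewrite eqxx.
rewrite (subsetP (circuit_sub cD)) //; split=> //; apply/orP; right.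
by apply/existsP; exists D; rewrite cD pD.
Qed.

(** The matroid is the direct sum of a component and the rest: by [circuit_meet_trans], a circuit
    meeting the component is contained in it. *)
Lemma component_indep p I : p \in ground M -> I \subset ground M ->
  I :&: component p \in indep M -> I :\: component p \in indep M -> I \in indep M.
Proof.
move=> hp sI hC hD; apply/negPn/negP=> nI; have [D cD sD] := dep_circuit sI nI.
have /subsetPn[d dD] : ~~ (D \subset I :\: component p).
  by apply/negP=> /(indepS hD); rewrite (negbTE (circuit_dep cD)).
rewrite inE (subsetP sD) // andbT negbK => dC.
have /subsetPn[q qD] : ~~ (D \subset I :&: component p).
  by apply/negP=> /(indepS hC); rewrite (negbTE (circuit_dep cD)).
rewrite inE (subsetP sD) //= => /componentP[]; right.
case/componentP: dC => [[e _]|[D' [cD' pD' dD']]]; first by exists D; rewrite -e.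
by apply: (circuit_meet_trans cD' cD) => //; apply/set0Pn; exists d; rewrite inE dD'.
Qed.

End Circuits.

(** * 2-sums *)

Section TwoSum.

Variable U : finType.
Implicit Types (I J K : {set U}).

Definition sum_set I J : {set U + U} := inl @: I :|: inr @: J.

Lemma in_sum_setl I J u : (inl u \in sum_set I J) = (u \in I).
Proof.
rewrite inE (mem_imset _ _ (@inl_inj U U)).
have -> : (inl u \in inr @: J) = false by apply/imsetP=> -[].
by rewrite orbF.
Qed.

Lemma in_sum_setr I J u : (inr u \in sum_set I J) = (u \in J).
Proof.
rewrite inE (mem_imset _ _ (@inr_inj U U)).
by have -> : (inr u \in inl @: I) = false by apply/imsetP=> -[].
Qed.

Definition in_sum_set := (in_sum_setl, in_sum_setr).

Lemma sum_setE (X : {set U + U}) : X = sum_set (inl @^-1: X) (inr @^-1: X).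
Proof. by apply/setP=> -[] u; rewrite in_sum_set inE. Qed.

Lemma card_sum_set I J : #|sum_set I J| = #|I| + #|J|.
Proof.
rewrite cardsU !card_imset; [|exact: inr_inj|exact: inl_inj].
have -> : inl @: I :&: inr @: J = set0 :> {set U + U}.
  by apply/setP=> z; rewrite !inE; apply/andP=> -[/imsetP[? _ ->] /imsetP[]].
by rewrite cards0 subn0.
Qed.

Lemma sum_setS I J I' J' : (sum_set I J \subset sum_set I' J') = (I \subset I') && (J \subset J').
Proof.
apply/subsetP/andP=> [h|[/subsetP hI /subsetP hJ] [] u]; last 2 first.
- by rewrite !in_sum_set; exact: hI.
- by rewrite !in_sum_set; exact: hJ.
split; apply/subsetP=> u.
  by have := h (inl u); rewrite !in_sum_set.
by have := h (inr u); rewrite !in_sum_set.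
Qed.

(** The augmentation axiom of the 2-sum when the first half of [I] is the smaller one; the other
    case follows by exchanging the halves. The difficulty is to keep [p] addable to one half, so
    when [p] cannot be added to [I2], it is [p |: I1] that is augmented. *)
Lemma two_sum_augment (M1 M2 : matroid U) p I1 I2 J1 J2 :
  p \notin J1 -> p \notin J2 -> p \notin I1 -> p \notin I2 ->
  I1 \in indep M1 -> I2 \in indep M2 ->
  (p |: I1 \in indep M1) || (p |: I2 \in indep M2) ->
  J1 \in indep M1 -> J2 \in indep M2 ->
  (p |: J1 \in indep M1) || (p |: J2 \in indep M2) ->
  #|I1| + #|I2| < #|J1| + #|J2| -> #|I1| < #|J1| ->
  (exists2 x, x \in J1 :\: I1 & (x |: I1 \in indep M1) &&
     ((p |: (x |: I1) \in indep M1) || (p |: I2 \in indep M2))) \/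
  (exists2 x, x \in J2 :\: I2 & (x |: I2 \in indep M2) &&
     ((p |: I1 \in indep M1) || (p |: (x |: I2) \in indep M2))).
Proof.
move=> pJ1 pJ2 pI1 pI2 hI1 hI2 hI hJ1 hJ2 hJ lt lt1.
have [pI2i|pI2i] := boolP (p |: I2 \in indep M2).
  have [x xJI hx] := indep_aug hI1 hJ1 lt1; left; exists x => //.
  by rewrite hx orbT.
rewrite (negbTE pI2i) orbF in hI.
have addp x J : x \in J :\: (p |: I1) -> p |: (x |: I1) \in indep M1 ->
    x \in J :\: I1 /\ (x |: I1 \in indep M1) && ((p |: (x |: I1) \in indep M1) || false).
  rewrite !inE negb_or -andbA => /and3P[_ -> ->] h; rewrite h (indepS h) //.
  exact: subsetUr.
have [lt2|le2] := ltnP #|p |: I1| #|J1|.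
  have [x xJI hx] := indep_aug hI hJ1 lt2; rewrite setUCA in hx.
  by left; have [h1 h2] := addp _ _ xJI hx; exists x.
rewrite cardsU1 pI1 in le2.
have [pJ1i|pJ1i] := boolP (p |: J1 \in indep M1).
  have lt3 : #|p |: I1| < #|p |: J1| by rewrite !cardsU1 pI1 pJ1 !add1n ltnS.
  have [x xJI hx] := indep_aug hI pJ1i lt3; rewrite setUCA in hx.
  left; have [h1 h2] := addp _ _ xJI hx; exists x => //.
  move: xJI h1; rewrite !inE negb_or => /andP[/andP[/negbTE -> _]] //.
(* Now |J1| = |I1| + 1, hence |I2| <= |J2|, and [p |: J2] augments [I2]; the new element is not [p],
   since [p |: I2] is dependent. *)
rewrite (negbTE pJ1i) /= in hJ.
have lt3 : #|I2| < #|p |: J2| by rewrite cardsU1 pJ2; move: lt le2; clear; lia.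
have [x xJI hx] := indep_aug hI2 hJ lt3; right; exists x; last by rewrite hx hI.
move: xJI; rewrite !inE => /andP[-> /orP[/eqP e|->]] //.
by rewrite -e hx in pI2i.
Qed.

(* The 2-sum at p of N with the restriction of a second copy of N to p |: A. *)
Variables (N : matroid U) (p : U) (A : {set U}).

Definition two_sum_ground := sum_set (ground N :\ p) A.

Definition two_sum_indep := [set X : {set U + U} | (X \subset two_sum_ground) &&
  [&& inl @^-1: X \in indep N, inr @^-1: X \in indep N &
      (p |: inl @^-1: X \in indep N) || (p |: inr @^-1: X \in indep N)]].

Lemma sum_set_preim I J : inl @^-1: (sum_set I J) = I /\ inr @^-1: (sum_set I J) = J.
Proof. by split; apply/setP=> u; rewrite inE in_sum_set. Qed.

Lemma two_sum_indepE I J : (sum_set I J \in two_sum_indep) =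
  [&& I \subset ground N :\ p, J \subset A, I \in indep N, J \in indep N
    & (p |: I \in indep N) || (p |: J \in indep N)].
Proof.
by rewrite inE sum_setS !(sum_set_preim I J).1 !(sum_set_preim I J).2 -andbA.
Qed.

Lemma two_sum_axiom : [set p] \in indep N -> p \notin A ->
  matroid_axiom two_sum_ground two_sum_indep.
Proof.
move=> hp pA; apply/matroid_axiomP; split.
- by move=> X; rewrite inE => /andP[].
- have -> : set0 = sum_set set0 set0 by rewrite /sum_set !imset0 setU0.
  by rewrite two_sum_indepE !sub0set indep0 setU0 hp.
- move=> X Y; rewrite (sum_setE X) (sum_setE Y) !two_sum_indepE sum_setS.
  move=> /and5P[s1 s2 h1 h2 h] /andP[sl sr].
  rewrite (subset_trans sl) // (subset_trans sr) // (indepS h1) // (indepS h2) //=.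
  by case/orP: h => h; [rewrite (indepS h (setUS _ sl)) | rewrite (indepS h (setUS _ sr)) orbT].
have pl I : I \subset ground N :\ p -> p \notin I.
  by move=> sI; apply/negP=> /(subsetP sI); rewrite !inE eqxx.
have pr I : I \subset A -> p \notin I by move=> sI; apply: contra pA; exact: (subsetP sI).
move=> X Y; rewrite (sum_setE X) (sum_setE Y); move: (inl @^-1: X) (inr @^-1: X) => I1 I2.
move: (inl @^-1: Y) (inr @^-1: Y) => J1 J2.
rewrite !two_sum_indepE !card_sum_set.
move=> /and5P[s1 s2 h1 h2 h] /and5P[t1 t2 k1 k2 k] lt.
have Al x : x \in J1 :\: I1 -> x |: I1 \in indep N ->
    (p |: (x |: I1) \in indep N) || (p |: I2 \in indep N) ->
    exists2 z, z \in sum_set J1 J2 :\: sum_set I1 I2 & z |: sum_set I1 I2 \in two_sum_indep.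
  move=> /setDP[xJ xI] hx hpx; exists (inl x); first by rewrite inE !in_sum_set xI.
  have -> : inl x |: sum_set I1 I2 = sum_set (x |: I1) I2.
    by apply/setP=> -[] u; rewrite in_setU1 !in_sum_set ?in_setU1.
  by rewrite two_sum_indepE subUset sub1set (subsetP t1) // s1 s2 hx h2 hpx.
have Ar x : x \in J2 :\: I2 -> x |: I2 \in indep N ->
    (p |: I1 \in indep N) || (p |: (x |: I2) \in indep N) ->
    exists2 z, z \in sum_set J1 J2 :\: sum_set I1 I2 & z |: sum_set I1 I2 \in two_sum_indep.
  move=> /setDP[xJ xI] hx hpx; exists (inr x); first by rewrite inE !in_sum_set xI.
  have -> : inr x |: sum_set I1 I2 = sum_set I1 (x |: I2).
    by apply/setP=> -[] u; rewrite in_setU1 !in_sum_set ?in_setU1.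
  by rewrite two_sum_indepE subUset sub1set (subsetP t2) // s1 s2 hx h1 hpx.
have [lt1|le1] := ltnP #|I1| #|J1|.
  have [] := two_sum_augment (pl _ t1) (pr _ t2) (pl _ s1) (pr _ s2) h1 h2 h k1 k2 k lt lt1.
    by case=> x xJI /andP[]; exact: Al.
  by case=> x xJI /andP[]; exact: Ar.
have lt2 : #|I2| < #|J2| by move: lt le1; clear; lia.
rewrite orbC in h; rewrite orbC in k; rewrite [#|I1| + _]addnC [#|J1| + _]addnC in lt.
have [] := two_sum_augment (pr _ t2) (pl _ t1) (pr _ s2) (pl _ s1) h2 h1 h k2 k1 k lt lt2.
  by case=> x xJI /andP[hx]; rewrite orbC; exact: Ar.
by case=> x xJI /andP[hx]; rewrite orbC; exact: Al.
Qed.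

End TwoSum.

(** * Recognizing twins, and separations of minors *)

Lemma rk_coloop_dual (T : finType) (M : matroid T) u : u \in ground M ->
  rk M (ground M :\ u) < rk M (ground M) -> rk (dual M) [set u] = 0.
Proof.
move=> hu; have su : [set u] \subset ground M by rewrite sub1set.
have := rk_dual su; rewrite cards1; clear; lia.
Qed.

Lemma twin_rk0 (T : finType) (M : matroid T) u v : u \in ground M -> v \in ground M ->
  u != v -> rk M [set u] = 0 -> rk M [set v] = 0 -> twin M u v.
Proof.
move=> hu hv nuv u0 v0; have : rk M [set u; v] = 0.
  by apply/eqP; rewrite -leqn0; have := rkU M [set u] [set v]; rewrite u0 v0.
by split; rewrite ?u0 ?v0.
Qed.

Lemma twin_rk1 (T : finType) (M : matroid T) u v : u \in ground M -> v \in ground M ->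
  u != v -> 0 < rk M [set u] -> 0 < rk M [set v] -> rk M [set u; v] <= 1 -> twin M u v.
Proof.
move=> hu hv nuv; have := rkS M (subsetUl [set u] [set v]).
have := rkS M (subsetUr [set u] [set v]) => h1 h2 h3 h4 h5.
by split=> //; move: h1 h2 h3 h4 h5; clear; lia.
Qed.

(* [rk A + rk B - rk (A :|: B)] is the connectivity of the partition {A, B}; it
   does not increase when C is contracted and A, B are cut down to Y, Z. *)
Lemma separation_minor (T : finType) (M : matroid T) (A B Y Z C : {set T}) k :
  rk M A + rk M B <= rk M (A :|: B) + k ->
  Y \subset A -> Z \subset B -> C \subset A :|: B ->
  rk M (Y :|: C) + rk M (Z :|: C) <= rk M (Y :|: Z :|: C) + rk M C + k.
Proof.
move=> hAB sY sZ sC.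
(* [A] and [B] are first cut down to [Y'] and [Z'], which keep the parts of [C] on their sides
   ([h1], [h2]); then [C] is contracted ([h3] to [h6]). *)
pose Y' := Y :|: (C :&: A); pose Z' := Z :|: (C :&: B).
have sY' : Y' \subset A by rewrite subUset sY subsetIr.
have sZ' : Z' \subset B by rewrite subUset sZ subsetIr.
have h1 : rk M (A :|: Z') + rk M Y' <= rk M A + rk M (Y' :|: Z').
  apply: rk_submod; first by rewrite setUS ?subsetUr.
  by rewrite subsetI sY' subsetUl.
have h2 : rk M (A :|: B) + rk M Z' <= rk M (A :|: Z') + rk M B.
  apply: rk_submod; first by rewrite setUAC subsetUl.
  by rewrite subsetI sZ' subsetUr.
have h3 : rk M (Y :|: C) + rk M (C :&: A) <= rk M Y' + rk M C.
  apply: rk_submod; first by rewrite setSU ?subsetUl.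
  by rewrite subsetI subsetUr subsetIl.
have h4 : rk M (Z :|: C) + rk M (C :&: B) <= rk M Z' + rk M C.
  apply: rk_submod; first by rewrite setSU ?subsetUl.
  by rewrite subsetI subsetUr subsetIl.
have h5 : rk M (Y' :|: Z') <= rk M (Y :|: Z :|: C).
  apply/rkS/subsetP=> z; rewrite /Y' /Z' !inE.
  by case: (z \in Y); case: (z \in Z); case: (z \in C).
have h6 : rk M C <= rk M (C :&: A) + rk M (C :&: B).
  by apply: leq_trans (rkU _ _ _); rewrite -setIUr rkS // subsetI subxx.
move: hAB h1 h2 h3 h4 h5 h6; clear; lia.
Qed.

Section Circuit.

Variables (U : finType) (N : matroid U) (p : U) (D0 : {set U}).
Hypotheses (cD0 : circuit N D0) (pD0 : p \in D0) (D0gt1 : 1 < #|D0|).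
Implicit Types (I J K : {set U}).

Let Cp := component N p.
Let A := Cp :\ p.

Lemma component_mem_indep y : y \in Cp -> [set y] \in indep N.
Proof.
have nonloop D q x : circuit N D -> q \in D -> x \in D -> x != q -> [set x] \in indep N.
  by move=> cD qD xD n; apply: (circuit_proper cD qD); rewrite sub1set !inE n.
case/componentP=> [[-> _]|[D [cD pD yD]]].
  have : 0 < #|D0 :\ p| by move: D0gt1; rewrite (cardsD1 p D0) pD0.
  by case/card_gt0P=> q; rewrite !inE => /andP[n qD]; apply: (nonloop D0 q); rewrite // eq_sym.
have [e|n] := eqVneq y p; last exact: (nonloop D p).
have : 0 < #|D0 :\ p| by move: D0gt1; rewrite (cardsD1 p D0) pD0.
by case/card_gt0P=> q; rewrite !inE => /andP[n qD]; rewrite e; apply: (nonloop D0 q); rewrite // eq_sym.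
Qed.

Lemma circuit_elt_ground : p \in ground N.
Proof. exact: (subsetP (circuit_sub cD0)). Qed.

Lemma component_sub : Cp \subset ground N.
Proof. by apply/subsetP=> u; rewrite inE => /andP[]. Qed.

Lemma component_refl : p \in Cp.
Proof. by rewrite inE circuit_elt_ground eqxx. Qed.

Lemma indep_componentU I J : I \subset Cp -> J \subset ground N :\: Cp ->
  (I :|: J \in indep N) = (I \in indep N) && (J \in indep N).
Proof.
move=> sI sJ; apply/idP/andP=> [h|[hI hJ]].
  by rewrite !(indepS h) ?subsetUl ?subsetUr.
apply: (@component_indep _ _ p); rewrite ?circuit_elt_ground //.
- by rewrite subUset (subset_trans sI component_sub) (subset_trans sJ (subsetDl _ _)).
- apply: indepS hI _; apply/subsetP=> x; rewrite in_setI in_setU => /andP[/orP[//|/(subsetP sJ)]].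
  by rewrite in_setD => /andP[/negbTE->].
- apply: indepS hJ _; apply/subsetP=> x; rewrite in_setD in_setU => /andP[n /orP[/(subsetP sI)|//]].
  by rewrite (negbTE n).
Qed.

(** [K] is a circuit through [p] and [y] without these two elements; contracting it makes [p] and
    [y] parallel. *)
Lemma component_link y : y \in A -> exists K,
  [/\ K \subset A, y \notin K, y |: K \in indep N, p |: K \in indep N
    & p |: (y |: K) \notin indep N].
Proof.
rewrite in_setD1 => /andP[nyp /componentP[[e _]|[D [cD pD yD]]]]; first by rewrite e eqxx in nyp.
exists (D :\ y :\ p); split.
- apply/subsetP=> z; rewrite !in_setD1 => /and3P[-> _ zD] /=.
  by apply/componentP; right; exists D.
- by rewrite !inE eqxx andbF.
- apply: (circuit_proper cD pD); apply/subsetP=> z; rewrite !inE.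
  by case/orP=> [/eqP->|/and3P[-> _ ->]] //; rewrite nyp yD.
- apply: (circuit_proper cD yD); apply/subsetP=> z; rewrite !inE.
  by case/orP=> [/eqP->|/and3P[_ -> ->]] //; rewrite eq_sym nyp pD.
apply: contra (circuit_dep cD) => h; apply: indepS h _; apply/subsetP=> z zD.
by rewrite !inE zD andbT; case: (z == p); case: (z == y).
Qed.

Lemma circuit_elt_indep : [set p] \in indep N.
Proof. by apply: component_mem_indep; exact: component_refl. Qed.

Lemma base_point_notin : p \notin A.
Proof. by rewrite !inE eqxx. Qed.

Let M := Matroid (two_sum_axiom circuit_elt_indep base_point_notin).

Lemma two_sum_component_indep I J : (sum_set I J \in indep M) =
  [&& I \subset ground N :\ p, J \subset A, I \in indep N, J \in indep N
    & (p |: I \in indep N) || (p |: J \in indep N)].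
Proof. exact: two_sum_indepE. Qed.

(** Contracting a link [K] in the right half lets [y] play [p], next to the whole left half. *)
Lemma two_sum_embed_left y : y \in A -> exists g C, embeds N M g C /\
  g @: ground N = sum_set (ground N :\ p) [set y].
Proof.
move=> yA; have [K [sK yK hyK hpK npyK]] := component_link yA.
have hK : K \in indep N by apply: indepS hyK (subsetUr _ _).
pose g u : U + U := if u == p then inr y else inl u.
have gI I : g @: I = sum_set (I :\ p) (if p \in I then [set y] else set0).
  apply/setP=> -[] u; rewrite in_sum_set.
    apply/imsetP/setD1P=> [[v vI]|[n uI]]; last by exists u; rewrite // /g (negbTE n).
    by rewrite /g; case: eqVneq => // n [->].
  apply/imsetP/idP=> [[v vI]|].
    by rewrite /g; case: eqVneq => // e [->]; rewrite -e vI inE.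
  case: ifP => // [pI|_]; last by rewrite inE.
  by rewrite inE => /eqP->; exists p; rewrite // /g eqxx.
have eN : g @: ground N = sum_set (ground N :\ p) [set y] by rewrite gI circuit_elt_ground.
exists g, (sum_set set0 K); split=> //; apply: embeds_indep.
- by move=> u v _ _; rewrite /g; case: eqVneq => [->|_]; case: eqVneq => [->|_] // [].
- by rewrite eN /= sum_setS subxx sub1set.
- by rewrite two_sum_component_indep sub0set sK indep0 hK hpK orbT.
- rewrite eN disjoints_subset; apply/subsetP=> -[] u; rewrite in_setC !in_sum_set ?in_set0 // in_set1 => uK.
  by apply: contra yK => /eqP<-.
move=> I sI; rewrite gI.
have -> : forall X, sum_set (I :\ p) X :|: sum_set set0 K = sum_set (I :\ p) (X :|: K).
  by move=> X; apply/setP=> -[] u; rewrite in_setU !in_sum_set ?in_setU // in_set0 orbF.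
have sIp : I :\ p \subset ground N :\ p by rewrite setSD.
rewrite two_sum_component_indep sIp; case: ifPn => pI.
  rewrite subUset sub1set yA sK setD1K // hyK (negbTE npyK) orbF /=.
  by case hI: (I \in indep N); rewrite ?andbF // (indepS hI) ?subsetDl.
rewrite set0U sK hK hpK orbT !andbT /=.
by have -> : I :\ p = I by [apply/setDidPl; rewrite disjoint_sym disjoints1].
Qed.

(** Contracting a link [K] in the left half lets [x] play [p]. The rest of the component is taken on
    the right and the elements outside it on the left, where [K] does not disturb them because of
    the direct sum. *)
Lemma two_sum_embed_right x : x \in A -> exists g C, embeds N M g C /\
  sum_set set0 A \subset g @: ground N.
Proof.
move=> xA; have [K [sK xK hxK hpK npxK]] := component_link xA.
have hK : K \in indep N by apply: indepS hxK (subsetUr _ _).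
have xC : x \in Cp by move: xA; rewrite in_setD1 => /andP[].
have nxp : x != p by move: xA; rewrite in_setD1 => /andP[].
have sKC : K \subset Cp by apply: subset_trans sK (subsetDl _ _).
have sA : A \subset Cp by apply: subsetDl.
have sAp : A \subset ground N :\ p by rewrite setSD ?component_sub.
have pC := component_refl.
pose g u : U + U := if u == p then inl x else if u \in Cp then inr u else inl u.
have gI I : g @: I = sum_set ((if p \in I then [set x] else set0) :|: (I :\: Cp)) ((I :&: Cp) :\ p).
  apply/setP=> -[] u; rewrite in_sum_set.
    rewrite in_setU in_setD; apply/imsetP/orP=> [[v vI]|].
      rewrite /g; case: eqVneq => [e [->]|_]; first by left; rewrite -e vI inE.
      by case: ifPn => // n [->]; right; rewrite n vI.
    case=> [|/andP[n uI]].
      by case: ifP; rewrite inE // => pI /eqP->; exists p; rewrite // /g eqxx.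
    exists u => //; rewrite /g (negbTE n); case: eqVneq => // e.
    by rewrite e pC in n.
  rewrite in_setD1 in_setI; apply/imsetP/and3P=> [[v vI]|[n uI uC]].
    by rewrite /g; case: eqVneq => // n; case: ifPn => // vC [->].
  by exists u; rewrite // /g (negbTE n) uC.
have eN : g @: ground N = sum_set ([set x] :|: (ground N :\: Cp)) A.
  by rewrite gI circuit_elt_ground (setIidPr component_sub).
exists g, (sum_set K set0); split; last by rewrite eN sum_setS sub0set subxx.
apply: embeds_indep.
- move=> u v _ _; rewrite /g; case: eqVneq => [->|_]; case: eqVneq => [->|_] //.
  + by case: ifPn => // n [e]; rewrite -e xC in n.
  + by case: ifPn => // n [e]; rewrite e xC in n.
  by case: ifPn => _; case: ifPn => _ // [].
- rewrite eN /= sum_setS subxx andbT subUset sub1set (subsetP sAp) //=.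
  apply/subsetP=> u; rewrite !inE => /andP[n uN]; rewrite uN andbT.
  by apply: contra n => /eqP->; move: pC; rewrite inE.
- by rewrite two_sum_component_indep sub0set (subset_trans sK sAp) indep0 hK hpK.
- rewrite eN disjoints_subset; apply/subsetP=> -[] u; rewrite in_setC !in_sum_set ?in_set0 // => uK.
  rewrite in_setU in_set1 in_setD (subsetP sKC) //= orbF.
  by apply: contra xK => /eqP<-.
move=> I sI; rewrite gI.
have -> : forall X Y, sum_set X Y :|: sum_set K set0 = sum_set (X :|: K) Y.
  by move=> X Y; apply/setP=> -[] u; rewrite in_setU !in_sum_set ?in_setU // in_set0 orbF.
have sIC : I :\: Cp \subset ground N :\: Cp by rewrite setSD.
have sICp : I :\: Cp \subset ground N :\ p.
  apply/subsetP=> u; rewrite in_setD in_setD1 => /andP[n uI]; rewrite (subsetP sI) // andbT.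
  by apply: contra n => /eqP->.
have sIA : (I :&: Cp) :\ p \subset A by rewrite setSD // subsetIr.
have eI : (I \in indep N) = (I :&: Cp \in indep N) && (I :\: Cp \in indep N).
  by rewrite -indep_componentU ?subsetIr // setID.
rewrite eI two_sum_component_indep sIA; case: ifPn => pI.
  rewrite setUAC.
  have sxK : [set x] :|: K \subset Cp by rewrite subUset sub1set xC sKC.
  rewrite subUset [_ :|: K \subset _]subUset sub1set (subsetP sAp) // (subset_trans sK sAp) sICp /=.
  rewrite (indep_componentU sxK sIC) hxK /=.
  have -> : (p |: (x |: K :|: (I :\: Cp)) \in indep N) = false.
    by apply: contraNF npxK => h; apply: indepS h _; rewrite setUS ?subsetUl.
  rewrite setD1K /= ?inE ?pI //; last by move: pC; rewrite inE.
  case hI: (I :&: Cp \in indep N); rewrite ?andbF ?andbT //=.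
  by rewrite (indepS hI (subsetDl _ [set p])) andbT.
rewrite set0U subUset sICp (subset_trans sK sAp) /= [_ :|: K]setUC.
rewrite (indep_componentU sKC sIC) hK /= setUA.
have spK : p |: K \subset Cp by rewrite subUset sub1set pC sKC.
rewrite (indep_componentU spK sIC) hpK /=.
have -> : (I :&: Cp) :\ p = I :&: Cp.
  by apply/setDidPl; rewrite disjoint_sym disjoints1 inE negb_and pI.
by case: (I :\: Cp \in indep N); rewrite ?andbF ?andbT.
Qed.

Hypothesis A_gt1 : 1 < #|A|.

Lemma two_sum_connected : matroid_connected N M.
Proof.
have [y0 yA0] : exists y, y \in A by apply/card_gt0P; apply: ltnW.
apply: conn_intro.
  rewrite /= card_sum_set; apply: leq_trans A_gt1 _; exact: leq_addl.
move=> [u|y] [v|z]; rewrite /= /two_sum_ground !in_sum_set => hu hv nuv.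
- have [g [C [emb eN]]] := two_sum_embed_left yA0.
  by exists g, C; rewrite eN !in_sum_set.
- have [g [C [emb eN]]] := two_sum_embed_left hv.
  by exists g, C; rewrite eN !in_sum_set in_set1 eqxx.
- have [g [C [emb eN]]] := two_sum_embed_left hu.
  by exists g, C; rewrite eN !in_sum_set in_set1 eqxx.
have [g [C [emb sN]]] := two_sum_embed_right yA0.
by exists g, C; split=> //; apply: (subsetP sN); rewrite in_sum_set.
Qed.

(** A basis [J] of the right side is traded for [L :\ p], where [L] is a basis of [p |: J]
    containing [p]. This costs at most one element, and as [p] can be added, the result is
    compatible with any independent set on the left. *)
Lemma two_sum_separation :
  rk M (sum_set set0 A) + rk M (sum_set (ground N :\ p) set0) <=
  rk M (sum_set set0 A :|: sum_set (ground N :\ p) set0) + 1.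
Proof.
have [X [hX sX <-]] := rk_basis M (sum_set set0 A).
have [Y [hY sY <-]] := rk_basis M (sum_set (ground N :\ p) set0).
move: hX sX hY sY; rewrite (sum_setE X) (sum_setE Y).
move: (inl @^-1: X) (inr @^-1: X) (inl @^-1: Y) (inr @^-1: Y) => X1 J I Y2.
rewrite !sum_setS !subset0 !two_sum_component_indep !card_sum_set.
move=> h /andP[/eqP e1 sJ] h' /andP[sI /eqP e2]; subst X1 Y2.
case/and5P: h => _ _ _ hJ _; case/and5P: h' => _ _ hI _ _.
rewrite cards0 add0n addn0.
have hE K : K \subset A -> K \in indep N -> p |: K \in indep N ->
    #|K| + #|I| <= rk M (sum_set set0 A :|: sum_set (ground N :\ p) set0).
  move=> sK hK hpK; rewrite addnC -card_sum_set; apply: indep_rk.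
    by rewrite two_sum_component_indep sI sK hI hK hpK orbT.
  apply/subsetP=> -[] u; rewrite in_setU !in_sum_set => h.
    by rewrite (subsetP sI) ?orbT.
  by rewrite (subsetP sK).
have [L [hL pL sL eL]] := rk_extend circuit_elt_indep (subsetUl [set p] J).
have pL' : p \in L by rewrite -sub1set.
have := hE (L :\ p); rewrite (setD1K pL') hL (indepS hL (subsetDl _ [set p])).
have sLJ : L :\ p \subset J.
  by apply/subsetP=> u; rewrite !inE => /andP[n /(subsetP sL)]; rewrite !inE (negbTE n).
rewrite (subset_trans sLJ sJ) => /(_ isT isT isT).
have := cardsD1 p L; rewrite pL' eL.
have := indep_rk hJ (subsetUr [set p] J).
clear; lia.
Qed.

Lemma component_noncoloop y : y \in Cp -> rk N (ground N :\ y) = rk N (ground N).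
Proof.
move=> yC; have yN := subsetP component_sub y yC.
rewrite -[in RHS](setD1K yN); case/componentP: yC => [[-> _]|[D [cD _ yD]]].
  by rewrite (circuit_rkU1 cD0 pD0) // setSD // (circuit_sub cD0).
by rewrite (circuit_rkU1 cD yD) // setSD // (circuit_sub cD).
Qed.

(** Loops of N on the left stay loops of the 2-sum, as coloops other than [p] stay coloops in
    [two_sum_coloop]. This serves to locate the loop and the coloop of an N-minor. *)
Lemma two_sum_loop u : [set u] \notin indep N -> rk M [set inl u] = 0.
Proof.
move=> nu; have /esym := rk_card M [set inl u]; rewrite cards1.
have : [set inl u] \notin indep M.
  have -> : [set inl u] = sum_set [set u] set0 by rewrite /sum_set imset_set1 imset0 setU0.
  by rewrite two_sum_component_indep (negbTE nu) !andbF.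
by rewrite indepE cards1; case: rk => [|[]].
Qed.

Lemma coloop_indepU1 u J : rk N (ground N :\ u) < rk N (ground N) ->
  J \in indep N -> u \notin J -> u |: J \in indep N.
Proof.
move=> lt hJ uJ; have sJ : J \subset ground N :\ u by rewrite subsetD1 indep_sub.
have := @rk_submod _ N (u |: J) (ground N :\ u) (ground N) J.
rewrite subsetI subsetUr sJ => /(_ _ isT) h; rewrite indepE eqn_leq rk_card /=.
have /h : ground N \subset u |: J :|: ground N :\ u.
  by apply/subsetP=> z zN; rewrite !inE zN andbT; case: (z == u); rewrite // orbT.
move: hJ lt; rewrite indepE cardsU1 uJ => /eqP->; clear; lia.
Qed.

Lemma two_sum_coloop u (S : {set U + U}) : u \in ground N -> u != p ->
  rk N (ground N :\ u) < rk N (ground N) -> inl u \notin S ->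
  rk M S < rk M (inl u |: S).
Proof.
move=> hu nup lt uS; have [I [hI sI <-]] := rk_basis M S.
have uI : inl u \notin I by apply: contra uS; exact: (subsetP sI).
have -> : #|I|.+1 = #|inl u |: I| by rewrite cardsU1 uI.
apply: indep_rk; last exact: setUS.
move: hI uI; rewrite (sum_setE I); move: (inl @^-1: I) (inr @^-1: I) => I1 I2.
have -> : inl u |: sum_set I1 I2 = sum_set (u |: I1) I2.
  by apply/setP=> -[] v; rewrite in_setU1 !in_sum_set ?in_setU1.
rewrite !two_sum_component_indep in_sum_set => /and5P[s1 -> h1 -> h] uI.
rewrite subUset sub1set in_setD1 nup hu s1 coloop_indepU1 //=.
case/orP: h => [h|->]; last by rewrite orbT.
by rewrite setUCA coloop_indepU1 // in_setU1 negb_or nup.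
Qed.

Lemma two_sum_not_hereditary : (forall u v, ~ twin N u v) ->
  (forall u v, ~ twin (dual N) u v) -> ~ minor_hereditary N.
Proof.
move=> noT noT' hN; have /card_gt1P[a [a' [aA a'A naa']]] := A_gt1.
have [nap aC] : a != p /\ a \in Cp by apply/andP; rewrite -in_setD1.
have aN := subsetP component_sub a aC.
have N2 : 2 <= #|ground N|.
  by apply: leq_trans D0gt1 _; apply: subset_leq_card; exact: circuit_sub.
(* Only [p] and [a] are missing on the left. Both lie in the component, so neither is a loop or a
   coloop, and [X] keeps every loop and coloop of N. *)
pose X := sum_set (ground N :\ p :\ a) [set a; a'].
have sX : X \subset ground M by rewrite sum_setS subsetDl subUset !sub1set aA.
have eX : #|X| = #|ground N|.
  rewrite card_sum_set cards2 naa' [RHS](cardsD1 p) circuit_elt_ground (cardsD1 a (_ :\ p)).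
  by rewrite in_setD1 nap aN addnC.
have [g [C [[injg sg sC dC hg] eg]]] := hereditary_embeds hN N2 two_sum_connected sX eX.
have inX z : z \in X -> exists2 u, u \in ground N & g u = z.
  by rewrite -eg => /imsetP[u hu ->]; exists u.
have inlX u : u \in ground N -> u != p -> u != a -> exists w, [/\ w \in ground N & g w = inl u].
  move=> hu np na; have [|w hw ew] := inX (inl u); last by exists w.
  by rewrite in_sum_setl !in_setD1 na np.
have [a1 ha1 ea1] : exists2 u, u \in ground N & g u = inr a.
  by apply: inX; rewrite in_sum_setr !inE eqxx.
have [a2 ha2 ea2] : exists2 u, u \in ground N & g u = inr a'.
  by apply: inX; rewrite in_sum_setr !inE eqxx orbT.
have na12 : a1 != a2.
  by apply: contra naa' => /eqP e; move: ea1; rewrite e ea2 => -[->].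
have s1 u : u \in ground N -> [set u] \subset ground N by rewrite sub1set.
(* If a loop [u] of N were placed on the right, the copy of [u] on the left, a loop of [M] in [X],
   would be the image of a second loop [w], a twin of [u]. The argument for coloops is dual. *)
have nonloop u b : u \in ground N -> g u = inr b -> 0 < rk N [set u].
  move=> hu eu; rewrite lt0n; apply/negP=> /eqP u0.
  have nu : [set u] \notin indep N by rewrite indepE u0 cards1.
  have [||w [hw ew]] := inlX u hu.
  - by apply: contra nu => /eqP->; exact: circuit_elt_indep.
  - by apply: contra nu => /eqP->; exact: component_mem_indep.
  have nuw : u != w by apply/eqP=> e; move: eu; rewrite e ew.
  have w0 : rk N [set w] = 0.
    apply/eqP; rewrite -leqn0 -(leq_add2r (rk M C)) -hg ?s1 // imset_set1 ew.
    by apply: leq_trans (rkU _ _ _) _; rewrite two_sum_loop.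
  exact: noT (twin_rk0 hu hw nuw u0 w0).
have noncoloop u b : u \in ground N -> g u = inr b -> 0 < rk (dual N) [set u].
  move=> hu eu; rewrite lt0n; apply/negP=> /eqP u0.
  have lt : rk N (ground N :\ u) < rk N (ground N).
    by have := rk_dual (s1 u hu); rewrite u0 cards1; clear; lia.
  have [||w [hw ew]] := inlX u hu.
  - by apply/eqP=> e; move: lt; rewrite e component_noncoloop ?component_refl // ltnn.
  - by apply/eqP=> e; move: lt; rewrite e component_noncoloop // ltnn.
  have nuw : u != w by apply/eqP=> e; move: eu; rewrite e ew.
  have nup : u != p by apply/eqP=> e; move: lt; rewrite e component_noncoloop ?component_refl // ltnn.
  have ltw : rk N (ground N :\ w) < rk N (ground N).
    rewrite -(ltn_add2r (rk M C)) -!hg ?subsetDl //.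
    have -> : g @: ground N :|: C = inl u |: (g @: (ground N :\ w) :|: C).
      by rewrite -{1}(setD1K hw) imsetU1 ew setUA.
    apply: two_sum_coloop => //; rewrite in_setU negb_or -ew; apply/andP; split.
      apply/imsetP=> -[v /setD1P[nv hv] e].
      by move: nv; rewrite (injg v w hv hw) ?eqxx.
    by rewrite (disjointFl dC) // imset_f.
  exact: noT' (twin_rk0 (M := dual N) hu hw nuw u0 (rk_coloop_dual hw ltw)).
pose Y := [set a1; a2].
have sY : Y \subset ground N by rewrite subUset !sub1set ha1.
have sep : rk N Y + rk N (ground N :\: Y) <= rk N (ground N) + 1.
  have sCE : C \subset sum_set set0 A :|: sum_set (ground N :\ p) set0.
    apply: subset_trans sC _; rewrite /= /two_sum_ground; apply/subsetP=> -[] u;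
    by rewrite in_setU !in_sum_set => ->; rewrite ?orbT.
  have sgY : g @: Y \subset sum_set set0 A.
    by rewrite imsetU !imset_set1 ea1 ea2 subUset !sub1set !in_sum_set aA.
  have sgZ : g @: (ground N :\: Y) \subset sum_set (ground N :\ p) set0.
    apply/subsetP=> _ /imsetP[v /setDP[hv nvY] ->].
    have : g v \in X by rewrite -eg imset_f.
    case ev: (g v) => [z|z]; rewrite !in_sum_set; first by case/setD1P.
    case/set2P=> ez; case/negP: nvY; rewrite in_set2.
      by rewrite (injg v a1) ?eqxx // ev ea1 ez.
    by rewrite (injg v a2) ?eqxx ?orbT // ev ea2 ez.
  have := separation_minor two_sum_separation sgY sgZ sCE.
  have -> : g @: Y :|: g @: (ground N :\: Y) = g @: ground N.
    by rewrite -imsetU -{1}(setIidPr sY) setID.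
  rewrite !hg ?subsetDl //; clear; lia.
have h1 := nonloop a1 _ ha1 ea1; have h2 := nonloop a2 _ ha2 ea2.
have h1' := noncoloop a1 _ ha1 ea1; have h2' := noncoloop a2 _ ha2 ea2.
(* If the pair has rank 2, then [sep] gives rk(E - Y) < rk(E), so its dual rank is at most 1 and it
   is a series pair. *)
have [le|gt] := leqP (rk N Y) 1; first exact: noT (twin_rk1 ha1 ha2 na12 h1 h2 le).
apply: noT' (twin_rk1 (M := dual N) ha1 ha2 na12 h1' h2' _).
have := rk_dual sY; rewrite cards2 na12 -/Y; move: sep gt; clear; lia.
Qed.

End Circuit.

(** * Combining the cases *)

Lemma twin_em (T : finType) (M : matroid T) :
  (forall u v, ~ twin M u v) \/ exists u v, twin M u v.
Proof.
have [/existsP[u /existsP[v /and5P[hu hv n /eqP eu /eqP ev]]]|/existsPn none] :=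
  boolP [exists u, exists v, [&& u \in ground M, v \in ground M, u != v,
    rk M [set u] == rk M [set u; v] & rk M [set v] == rk M [set u; v]]].
  by right; exists u, v.
left=> u v [hu hv n eu ev]; have /existsPn/(_ v) := none u.
by rewrite hu hv n eu ev eqxx.
Qed.

(** A circuit with exactly two elements would be a pair of twins, so [D] has at least three, all in
    the component. *)
Lemma circuit_component_gt1 (U : finType) (N : matroid U) p (D : {set U}) :
  (forall u v, ~ twin N u v) -> circuit N D -> p \in D -> 1 < #|D| ->
  1 < #|component N p :\ p|.
Proof.
move=> noT cD pD D1; have sD : D :\ p \subset component N p :\ p.
  by apply/setSD/subsetP=> y yD; apply/componentP; right; exists D.
apply: leq_trans (subset_leq_card sD).
have cDp := cardsD1 p D; rewrite pD in cDp.
rewrite leqNgt; apply/negP=> lt.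
have /eqP/cards1P[q eq] : #|D :\ p| = 1 by move: lt D1 cDp; clear; lia.
have : q \in D :\ p by rewrite eq set11.
case/setD1P=> nqp qD.
have eD : D = [set p; q] by rewrite -(setD1K pD) eq.
have rD : rk N D = 1.
  rewrite -(circuit_rk cD pD) eq; apply/eqP; rewrite -(cards1 q) -indepE -eq.
  exact: circuit_proper cD pD (subxx _).
have e1 : [set p] = D :\ q.
  by rewrite eD; apply/setP=> z; rewrite !inE; case: (eqVneq z p) => [->|_] /=; rewrite ?andbT ?andNb // eq_sym nqp.
apply: (noT p q); split; rewrite ?(subsetP (circuit_sub cD)) // 1?eq_sym // -eD.
  by rewrite e1 (circuit_rk cD).
by rewrite -eq (circuit_rk cD).
Qed.

(** When all circuits are loops, every element is a loop or a coloop. Without twins in N and its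
    dual there is at most one of each, so N is a loop plus a coloop. *)
Lemma no_circuit_not_hereditary (U : finType) (N : matroid U) :
  2 <= #|ground N| -> (forall u v, ~ twin N u v) -> (forall u v, ~ twin (dual N) u v) ->
  (forall D, circuit N D -> #|D| <= 1) -> ~ minor_hereditary N.
Proof.
move=> /card_gt1P[u [v [hu hv nuv]]] noT noT' loops.
have indN (I : {set U}) : I \subset ground N -> (forall x, x \in I -> [set x] \in indep N) -> I \in indep N.
  move=> sI hI; apply/negPn/negP=> nI; have [D cD sD] := dep_circuit sI nI.
  have [e|[x xD]] := set_0Vmem D; first by have := circuit_dep cD; rewrite e indep0.
  have := circuit_dep cD; have /eqP <- : [set x] == D.
    by rewrite eqEcard sub1set xD cards1 loops.
  by rewrite hI // (subsetP sD).
have loop0 x : [set x] \notin indep N -> rk N [set x] = 0.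
  by have := rk_card N [set x]; rewrite indepE cards1; case: rk => [|[]].
have coloop0 x : x \in ground N -> [set x] \in indep N -> rk (dual N) [set x] = 0.
  move=> hx ix; apply: rk_coloop_dual => //.
  have [I [hI sI <-]] := rk_basis N (ground N :\ x).
  have xI : x \notin I by apply/negP=> /(subsetP sI); rewrite !inE eqxx.
  have hxI : x |: I \in indep N.
    apply: indN => [|y]; first by rewrite subUset sub1set hx indep_sub.
    by case/setU1P=> [->//|yI]; apply: indepS hI _; rewrite sub1set.
  by have := indep_rk hxI (indep_sub hxI); rewrite cardsU1 xI.
have two x y : x \in ground N -> y \in ground N -> x != y ->
    ([set x] \in indep N) = ([set y] \notin indep N).
  move=> hx hy n; have [ix|nx] := boolP ([set x] \in indep N);
    have [iy|ny] := boolP ([set y] \in indep N) => //.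
    by case: (noT' x y (twin_rk0 (M := dual N) hx hy n (coloop0 x hx ix) (coloop0 y hy iy))).
  by case: (noT x y (twin_rk0 hx hy n (loop0 x nx) (loop0 y ny))).
(* By [two], exactly one of [u] and [v] is a loop; let it be [u]. *)
wlog nu : u v hu hv nuv / [set u] \notin indep N.
  move=> h; have [iu|nu] := boolP ([set u] \in indep N); last exact: (h u v).
  by apply: (h v u) => //; [rewrite eq_sym | rewrite -(two u v)].
have iv : [set v] \in indep N by rewrite (two v u) // eq_sym.
have gN : ground N = [set u; v].
  apply/setP=> w; rewrite !inE; apply/idP/orP=> [hw|[]/eqP-> //].
  have [_|nwu] := eqVneq w u; first by left.
  have [_|nwv] := eqVneq w v; first by right.
  by have := two w u hw hu nwu; rewrite (two w v hw hv nwv) iv nu.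
apply: (loop_coloop_not_hereditary nuv gN) => I sI; apply/idP/idP=> [hI|uI].
  by apply: contra nu => uI; apply: indepS hI _; rewrite sub1set.
apply: indN => // x xI; have := subsetP sI x xI; rewrite gN => /set2P[e|-> //].
by rewrite -e xI in uI.
Qed.

Theorem theorem1p1 (U : finType) (N : matroid U)
  (cardN : 2 <= #|ground N|)
  (hN : forall (T : finType) (M : matroid T),
     matroid_connected N M -> #|ground N| < #|ground M| ->
     forall e : T, e \in ground M ->
       matroid_connected N (deletion M [set e]) \/
       matroid_connected N (contraction M [set e])) :
  [\/ matroid_iso N (uniform 1 2),
      matroid_iso N (uniform 0 2)
    | matroid_iso N (uniform 2 2)].
Proof.
have rank_le1_or_twin V (L : matroid V) : minor_hereditary L ->
    (exists u v, twin L u v) -> #|ground L| = 2 /\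
    exists2 r, r <= 1 & forall I : {set V}, I \subset ground L -> (I \in indep L) = (#|I| <= r).
  by move=> hL [u [v tw]]; exact: twin_hereditary_uniform hL tw.
have [noT|/(rank_le1_or_twin _ _ hN)[c2 [r r1 hr]]] := twin_em N; last first.
  by case: r r1 hr => [|[|//]] _ hr; [constructor 2 | constructor 1]; exact: iso_uniform.
have [noT'|/(rank_le1_or_twin _ _ (dual_hereditary hN))[c2 [r r1 hr]]] := twin_em (dual N); last first.
  (* The dual is U_{r,2} with r at most 1, so N is U_{2-r,2}. *)
  have h (I : {set U}) : I \subset ground N -> (I \in indep N) = (#|I| <= 2 - r).
    by rewrite -[N]dualK -c2 => sI; apply: dual_uniform => //; rewrite c2 (leq_trans r1).
  by case: r r1 hr h => [|[|//]] _ hr h; [constructor 3 | constructor 1]; exact: iso_uniform.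
exfalso; have [/existsP[D /andP[cD D1]]|none] := boolP [exists D, circuit N D && (1 < #|D|)].
  have /card_gt0P[p pD] := ltnW D1.
  exact: (two_sum_not_hereditary cD pD D1 (circuit_component_gt1 noT cD pD D1) noT noT' hN).
apply: (no_circuit_not_hereditary cardN noT noT' _ hN) => D cD; rewrite leqNgt.
by apply: contra none => D1; apply/existsP; exists D; rewrite cD.
Qed.
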